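(* Let $(X,\|\cdot\|)$ be a Banach space. Then the following conditions are equivalent: (i) $X$ has a $1$-projectional skeleton. (ii) There is a convex symmetric set induced by a retractional skeleton in $(B_{X^*},w^* )$. Moreover, if $D$ is a $1$-norming (linear) subspace of $X^*$, then: (iii) If $D$ is a set induced by a $1$-projectional skeleton in $X$, then $D\cap B_{X^*}$ is induced by a retractional skeleton in $(B_{X^*},w^* )$. (iv) $D$ is a subset of a set induced by a $1$-projectional skeleton in $X$ if and only if $D\cap B_{X^*}$ is a subset of a set induced by a retractional skeleton in $(B_{X^*},w^* )$.
   Context: All topological spaces are Hausdorff; Banach spaces are real. $B_X$ denotes the closed unit ball of a Banach space $X$; $w^*$ is the weak$^*$ topology. A set $D\subset X^*$ is $r$-norming if $\|x\|\le r\cdot\sup\{|x^*(x)|: x^*\in D\cap B_{X^*}\}$ for every $x\in X$. A partially ordered set $\Gamma$ is up-directed if any two elements have an upper bound in $\Gamma$, and $\sigma$-complete if every increasing sequence in $\Gamma$ has a supremum in $\Gamma$. A projectional skeleton in a Banach space $X$ is a family $\{P_s\}_{s\in\Gamma}$ of bounded linear projections on $X$, indexed by an up-directed $\sigma$-complete partially ordered set $\Gamma$, such that: (i) each $P_sX$ is separable; (ii) $X=\bigcup_{s\in\Gamma}P_sX$; (iii) $s\le t\Rightarrow P_s=P_s\circ P_t=P_t\circ P_s$; (iv) if $s_1<s_2<\cdots$ in $\Gamma$ and $t=\sup_n s_n$, then $P_tX=\overline{\bigcup_n P_{s_n}X}$. It is an $r$-projectional skeleton ($r\ge1$) if moreover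 $\|P_s\|\le r$ for all $s\in\Gamma$. The set induced by the projectional skeleton is $\bigcup_{s\in\Gamma}P_s^*[X^*]\subset X^*$. A retractional skeleton in a compact space $K$ is a family $\{r_s\}_{s\in\Gamma}$ of (continuous) retractions of $K$ into itself, indexed by an up-directed $\sigma$-complete partially ordered set $\Gamma$, such that: (i) $r_s[K]$ is metrizable for each $s$; (ii) $x=\lim_{s\in\Gamma}r_s(x)$ for every $x\in K$; (iii) $s\le t\Rightarrow r_s=r_s\circ r_t=r_t\circ r_s$; (iv) if $s_1<s_2<\cdots$ in $\Gamma$ and $t=\sup_n s_n$, then $r_t(x)=\lim_n r_{s_n}(x)$ for every $x\in K$. The set induced by this retractional skeleton is $\bigcup_{s\in\Gamma}r_s[K]$. *)

(* Defs.v *)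
From HB Require Import structures.
From mathcomp Require Import all_boot all_order all_algebra.
From mathcomp Require Import all_classical all_reals all_analysis.

Set Implicit Arguments.
Unset Strict Implicit.
Unset Printing Implicit Defensive.

Import Order.TTheory GRing.Theory Num.Theory.
Import numFieldNormedType.Exports.

Local Open Scope classical_set_scope.
Local Open Scope ring_scope.

(* Only meaningful for bounded f: the supremum of an unbounded set is 0. *)
Definition opnorm {R : realType} {V W : normedModType R} (f : V -> W) : R :=
  sup [set `|f x| | x in [set x : V | `|x| <= 1]].

Section DualSpace.
Context {R : realType}.
Variable X : normedModType R.

Definition dual_pred : {pred X -> R^o} :=
  fun f => `[< linear f /\ continuous f >].

Lemma dual_pred_submod : submod_closed dual_pred.
Proof.
split.
  apply/asboolP; split; last exact: cst_continuous.
  by move=> a x y /=; rewrite /= scaler0 addr0.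
move=> a f g /asboolP[lf cf] /asboolP[lg cg]; apply/asboolP; split.
  move=> b x y; rewrite [LHS]/(a *: f _ + g _) lf lg.
  change (a * (b * f x + f y) + (b * g x + g y) =
          b * (a * f x + g x) + (a * f y + g y) :> R).
  by rewrite !mulrDr addrACA !mulrA [b * a]mulrC.
move=> x; apply: (@continuousD _ _ _ (fun y => a *: f y) g) (cg x).
exact: continuousZl_tmp (cf x).
Qed.

HB.instance Definition _ :=
  GRing.isSubmodClosed.Build R (X -> R^o) dual_pred dual_pred_submod.

Record dual := Dual {
  dual_fun :> X -> R^o;
  dual_funP : dual_fun \in dual_pred }.

HB.instance Definition _ := [isSub for dual_fun].
HB.instance Definition _ := [Choice of dual by <:].
HB.instance Definition _ := [SubChoice_isSubLmodule of dual by <:].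

(* The topology of pointwise convergence on X. *)
Definition weak_star : Type :=
  initial_topology (dual_fun : dual -> {ptws X -> R^o}).
HB.instance Definition _ := Topological.on weak_star.

Definition dual_ball : set weak_star := [set f : dual | opnorm f <= 1].

End DualSpace.
Arguments dual_ball {R} X _.

Section DualSubsets.
Context {R : realType} {X : normedModType R}.

Definition linear_subspace (D : set (dual X)) : Prop :=
  submod_closed [pred f | f \in D].

Definition symmetric_set (A : set (dual X)) : Prop :=
  forall f, A f -> A (- f).

Definition norming (r : R) (D : set (dual X)) : Prop :=
  forall x : X, `|x| <= r * sup [set `|f x| | f in D `&` dual_ball X].

(* The set P^*[X^*], for P linear and bounded. *)
Definition adjoint_range (P : X -> X) : set (dual X) :=
  [set g | exists f : dual X, forall x, g x = f (P x)].

End DualSubsets.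

Section DirectedSets.
Context {d : Order.disp_t}.
Variable Gamma : porderType d.

Definition up_directed : Prop :=
  forall s t : Gamma, exists u : Gamma, (s <= u)%O /\ (t <= u)%O.

(* Increasing sequences need not be strictly increasing here. *)
Definition sigma_complete : Prop :=
  forall u : nat -> Gamma, nondecreasing_seq u -> exists t, isLub (range u) t.

Definition up_filter : set_system Gamma :=
  filter_from setT (fun s => [set t | (s <= t)%O]).

End DirectedSets.
Arguments up_filter {d} Gamma _.

Definition separable {T : topologicalType} (A : set T) : Prop :=
  exists C : set T, [/\ countable C, C `<=` A & A `<=` closure C].

Definition metrizable (R : realType) (T : topologicalType) : Prop :=
  exists dist : T -> T -> R,
    [/\ forall x y, 0 <= dist x y,
        forall x y, dist x y = 0 <-> x = y,
        forall x y, dist x y = dist y x,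
        forall x y z, dist x z <= dist x y + dist y z &
        forall x, nbhs x = filter_from [set e : R | 0 < e]
                             (fun e => [set y | dist x y < e])].

Section ProjectionalSkeleton.
Context {R : realType}.
Variable X : normedModType R.

Record projectional_skeleton {d} {Gamma : porderType d}
    (P : Gamma -> {linear X -> X}) : Prop := {
  ps_up_directed : up_directed Gamma;
  ps_sigma_complete : sigma_complete Gamma;
  ps_bounded : forall s, bounded_near (P s) (nbhs (0 : X));
  ps_projection : forall s x, P s (P s x) = P s x;
  ps_separable : forall s, separable (range (P s));
  ps_cover : \bigcup_s range (P s) = [set: X];
  ps_compat : forall s t, (s <= t)%O -> forall x,
    P s x = P s (P t x) /\ P s x = P t (P s x);
  ps_sup : forall (u : nat -> Gamma) t,
    increasing_seq u -> isLub (range u) t ->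
    range (P t) = closure (\bigcup_n range (P (u n))) }.

Record r_projectional_skeleton (r : R) {d} {Gamma : porderType d}
    (P : Gamma -> {linear X -> X}) : Prop := {
  rps_skeleton : projectional_skeleton P;
  rps_norm : forall s, opnorm (P s) <= r }.

Definition has_projectional_skeleton (r : R) : Prop :=
  exists d (Gamma : porderType d) (P : Gamma -> {linear X -> X}),
    r_projectional_skeleton r P.

Definition induced_by_projectional_skeleton (r : R) (D : set (dual X)) : Prop :=
  exists d (Gamma : porderType d) (P : Gamma -> {linear X -> X}),
    r_projectional_skeleton r P /\ D = \bigcup_s adjoint_range (P s).

End ProjectionalSkeleton.

Section RetractionalSkeleton.
Variables (R : realType) (K : topologicalType).

(* Compactness and the Hausdorff property are properties of K, not of the
   family of retractions; they are not required here. *)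
Record retractional_skeleton {d} {Gamma : porderType d}
    (r : Gamma -> K -> K) : Prop := {
  rs_up_directed : up_directed Gamma;
  rs_sigma_complete : sigma_complete Gamma;
  rs_continuous : forall s, continuous (r s);
  rs_retraction : forall s x, r s (r s x) = r s x;
  rs_metrizable : forall s, metrizable R (set_type (range (r s)));
  rs_lim : forall x, r s x @[s --> up_filter Gamma] --> x;
  rs_compat : forall s t, (s <= t)%O -> forall x,
    r s x = r s (r t x) /\ r s x = r t (r s x);
  rs_sup : forall (u : nat -> Gamma) t,
    increasing_seq u -> isLub (range u) t ->
    forall x, r (u n) x @[n --> \oo] --> r t x }.

Definition induced_by_retractional_skeleton (S : set K) : Prop :=
  exists d (Gamma : porderType d) (r : Gamma -> K -> K),
    retractional_skeleton r /\ S = \bigcup_s range (r s).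

End RetractionalSkeleton.

Section DualBall.
Context {R : realType} {X : normedModType R}.

(* set_type (dual_ball X) is the space (B_{X^*}, w^* ). *)
Definition to_ball (D : set (dual X)) : set (set_type (dual_ball X)) :=
  [set f | D (set_val f)].

Definition of_ball (A : set (set_type (dual_ball X))) : set (dual X) :=
  [set set_val f | f in A].

End DualBall.

(* Main.v *)
From HB Require Import structures.
Require Import Defs.
From mathcomp Require Import all_boot all_order all_algebra.
From mathcomp Require Import all_classical all_reals all_analysis.
From mathcomp Require Import ring lra.
Import Order.TTheory GRing.Theory Num.Theory.
Import numFieldNormedType.Exports.
Local Open Scope classical_set_scope.
Local Open Scope ring_scope.

Set Implicit Arguments.
Unset Strict Implicit.
Unset Printing Implicit Defensive.

(** The two kinds of skeleton are adjoint to each other. Writing B for the dual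
    ball, a projection P of norm at most one acts on B by composition,
    f |-> f o P, and the axioms of a projectional skeleton transpose to those of
    a retractional one. This gives every implication from X to B
    ([adjoint_retractional_skeleton]); the range of such an adjoint retraction
    is metrizable because countably many vectors determine its members
    ([metrizable_of_countable]).

    The way back cannot transpose, since the retractions r_s need not be linear.
    They only serve to find small well-behaved pieces of X and of its dual. Let A
    be a symmetric midpoint-closed norming set of functionals inside the induced
    set. A piece consists of a countable set C of vectors, a countable subset F
    of A and an index s; it is closed when C is a rational vector space, F is
    symmetric and midpoint-closed, F norms C, F lies in the range of r_s, and the
    values of a functional on C determine its image under r_s. Consequently C
    separates the points of the closure of F, each of which r_s fixes.

    A closed piece carries a projection of norm one onto the closure Y of C: P x
    is the unique y in Y on which all of F takes the same values as on x
    ([exists_projection]). Uniqueness and the norm bound hold because F norms Y.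
    For existence, suppose that no y in Y is within e of x for the
    seminorm sup over F. Minimising a finite sum of squares over the compact
    closure of F ([nearest_point]) yields, for any finitely many vectors of C, a
    functional in that closure with value e at x which vanishes on them; by
    compactness one of them vanishes on C, hence is zero because C
    separates, which is absurd. This replaces an appeal to the bipolar and
    Krein-Smulian theorems.

    Closed pieces are cofinal ([exists_closed_piece]): each condition can be
    met in one further step by adding countably many vectors and functionals
    and enlarging s, and the union of countably many steps meets all of them. For
    the last condition, a continuous map from B to a metrizable space depends on
    countably many coordinates ([countable_determining]), and r_s is a limit of
    the r_(s_n). For the same reason increasing unions of closed pieces are
    closed, so that the closed pieces, ordered componentwise, index a
    1-projectional skeleton ([projectional_skeleton_of_retractional]).

    With A equal to the intersection of D and B this proves the remaining half
    of the statement on a norming subspace D. With A the given convex symmetric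
    set it gives the projectional skeleton of X; there A is norming because the
    retractions make it dense in B, and B is norming by Hahn-Banach. *)

(** * Functionals and the weak-star ball *)

Section Functionals.
Context {R : realType} {X : normedModType R}.
Implicit Types (f g : dual X) (x y : X).

Lemma dual_linear f : linear (dual_fun f).
Proof. by have /asboolP[] := dual_funP f. Qed.

Lemma dual_continuous f : continuous (dual_fun f).
Proof. by have /asboolP[] := dual_funP f. Qed.

Definition dual_lin f : {linear X -> R^o} :=
  HB.pack (dual_fun f) (GRing.isLinear.Build _ _ _ _ (dual_fun f) (dual_linear f)).

Lemma opnorm_le1 (V W : normedModType R) (P : {linear V -> W}) :
  bounded_near P (nbhs (0 : V)) ->
  opnorm P <= 1 <-> forall v, `|P v| <= `|v|.
Proof.
move=> bP; split=> [P1 v|P1]; last first.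
  apply: ge_sup; first by exists `|P 0|, 0 => //=; rewrite normr0.
  by move=> _ [v /= v1 <-]; exact: le_trans v1.
have [->|v0] := eqVneq v 0; first by rewrite linear0 !normr0.
have nv : 0 < `|v| by rewrite normr_gt0.
have : `|P (`|v|^-1 *: v)| <= 1.
  apply: le_trans P1; apply: ub_le_sup; last first.
    exists (`|v|^-1 *: v) => //=.
    by rewrite normrZ normfV normr_id mulVf ?gt_eqF.
  move: bP => /bounded_funP/(_ 1)[M PM]; exists M.
  by move=> _ [z /= z1 <-]; exact: PM.
by rewrite linearZ normrZ normfV normr_id ler_pdivrMl// mulr1.
Qed.

Lemma dual_ballP f : dual_ball X f <-> forall x, `|f x : R| <= `|x|.
Proof.
apply: (@opnorm_le1 X R^o (dual_lin f)).
exact/linear_bounded_continuous/dual_continuous.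
Qed.

Lemma dual_of_bounded (h : X -> R) : linear (h : X -> R^o) ->
  (forall x, `|h x| <= `|x|) -> exists f : dual X, dual_fun f = h.
Proof.
move=> lh h1.
pose H : {linear X -> R^o} := HB.pack (h : X -> R^o)
  (GRing.isLinear.Build _ _ _ _ (h : X -> R^o) lh).
have hP : (h : NormedModule.sort X -> R^o) \in @dual_pred R X.
  apply/asboolP; split=> //; apply: (@bounded_linear_continuous _ _ _ H).
  apply/bounded_funP => r; exists r => x; apply: le_trans; exact: h1.
by exists (Dual hP).
Qed.

Local Notation B := (set_type (dual_ball X)).

Definition ev (b : B) : X -> R := dual_fun (set_val b : dual X).

Lemma evD b x y : ev b (x + y) = ev b x + ev b y.
Proof. exact: (linearD (dual_lin (set_val b))). Qed.

Lemma evN b x : ev b (- x) = - ev b x.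
Proof. exact: (linearN (dual_lin (set_val b))). Qed.

Lemma evB b x y : ev b (x - y) = ev b x - ev b y.
Proof. exact: (linearB (dual_lin (set_val b))). Qed.

Lemma evZ b a x : ev b (a *: x) = a * ev b x.
Proof. exact: (linearZZ (dual_lin (set_val b))). Qed.

Lemma ev_sum b I (r : seq I) (F : I -> X) :
  ev b (\sum_(i <- r) F i) = \sum_(i <- r) ev b (F i).
Proof. exact: (linear_sum (dual_lin (set_val b))). Qed.

Lemma ev_le b x : `|ev b x| <= `|x|.
Proof. by have /dual_ballP := set_valP b; exact. Qed.

Lemma ball_ofP f : (forall x, `|f x : R| <= `|x|) ->
  exists b : B, (set_val b : dual X) = f.
Proof. by move=> /dual_ballP/mem_set bf; exists (SigSub bf). Qed.

Lemma ball_of_linear (h : X -> R) : linear (h : X -> R^o) ->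
  (forall x, `|h x| <= `|x|) -> exists b, ev b = h.
Proof.
move=> lh h1; have [f fh] := dual_of_bounded lh h1.
have [|b bf] := @ball_ofP f; first by move=> x; rewrite fh; exact: h1.
by exists b; rewrite /ev bf.
Qed.

Lemma ev_inj (b c : B) : ev b =1 ev c -> b = c.
Proof. by move=> bc; apply/val_inj/val_inj/funext => x; exact: bc. Qed.

(** The point of entry to the topology of the ball: it is twice an initial
    topology, over the space of pointwise convergence. *)
Lemma ball_cvgP (F : set_system B) (b : B) : Filter F ->
  F --> b <-> forall x, ev g x @[g --> F] --> (ev b x : R^o).
Proof.
move=> FF.
have c1 : continuous (@set_val _ (dual_ball X)) by exact: initial_continuous.
have c2 : continuous ((fun f => dual_fun f) : weak_star X -> {ptws X -> R^o}).
  exact: initial_continuous.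
have H : F --> b <->
    {ptws, (fun g : B => (ev g : X -> R^o)) @ F --> (ev b : X -> R^o)}.
  split=> [Fb U Ub|Fb U].
  - by apply: Fb; have := c1 b _ (c2 _ _ Ub).
  - rewrite nbhsE => -[_ [[V [V' oV' <-] <-] Vb] sVU].
    apply: (filterS sVU).
    have : nbhs (ev b : {ptws X -> R^o}) V' by apply: open_nbhs_nbhs.
    by move/Fb.
rewrite H; exact: pointwise_cvgP.
Qed.

End Functionals.

Section BallTopology.
Context {R : realType} {X : normedModType R}.
Local Notation B := (set_type (dual_ball X)).
Implicit Types (b g : B) (x : X).

Lemma ev_cvg b x : ev g x @[g --> b] --> (ev b x : R^o).
Proof. by have [H _] := @ball_cvgP R X (nbhs b) b _; apply: H. Qed.

(** The basic neighbourhoods generate a filter that converges pointwise, so it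
    is finer than the neighbourhood filter. *)
Lemma ball_basis b (U : set B) : nbhs b U ->
  exists E : seq X, exists2 e : R, 0 < e &
    forall g, (forall x, x \in E -> `|ev b x - ev g x| < e) -> U g.
Proof.
move=> bU.
pose F := filter_from [set p : seq X * R | 0 < p.2]
  (fun p => [set g | forall x, x \in p.1 -> `|ev b x - ev g x| < p.2]).
have FF : Filter F.
  apply: filter_from_filter; first by exists ([::], 1) => /=.
  move=> [E1 e1] [E2 e2] /= e10 e20; exists (E1 ++ E2, Num.min e1 e2) => /=.
    by rewrite lt_min e10.
  by move=> g gE; split=> x xE; have := gE x; rewrite mem_cat xE ?orbT lt_min;
    move=> /(_ isT)/andP[].
have : F --> b.
  apply/ball_cvgP => x; apply/cvgrPdist_lt => e e0.
  by exists ([:: x], e) => //= g; apply; rewrite inE.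
by move=> /(_ _ bU) [[E e] /= e0 EU]; exists E, e.
Qed.

Lemma nbhs_basic b (E : seq X) (e : R) : 0 < e ->
  nbhs b [set g | forall x, x \in E -> `|ev b x - ev g x| < e].
Proof.
move=> e0; elim: E => [|y E IHE]; first by apply: filterS filterT => g _ x.
have H : \forall g \near b, `|ev b y - ev g y| < e.
  by have /cvgrPdist_lt := @ev_cvg b y; exact.
apply: filterS2 IHE H => g gE gy x; rewrite inE => /predU1P[->//|]; exact: gE.
Qed.

Lemma closure_ballP (A : set B) b : closure A b <->
  forall (E : seq X) (e : R), 0 < e ->
    exists2 g, A g & forall x, x \in E -> `|ev b x - ev g x| < e.
Proof.
split=> [Ab E e e0|Ab U /ball_basis[E [e e0 EU]]].
  by have [g [Ag gE]] := Ab _ (nbhs_basic b E e0); exists g.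
by have [g Ag gE] := Ab E e e0; exists g; split => //; exact: EU.
Qed.

Lemma sub_ball_basis (K : set B) (k : set_type K) (U : set (set_type K)) :
  nbhs k U <-> exists E : seq X, exists2 e : R, 0 < e &
    forall g : set_type K,
      (forall x, x \in E -> `|ev (set_val k) x - ev (set_val g) x| < e) -> U g.
Proof.
split=> [|[E [e e0 EU]]].
  rewrite nbhsE => -[_ [[V oV <-] Vk] sVU].
  have /ball_basis[E [e e0 EV]] : nbhs (set_val k) V by exact: open_nbhs_nbhs.
  by exists E, e => // g gE; apply/sVU/EV.
have cK : continuous (@set_val _ K) by exact: initial_continuous.
have := cK k _ (nbhs_basic (set_val k) E e0).
by apply: (@filterS _ _ (nbhs_filter k)) => g; exact: EU.
Qed.

(** Banach-Alaoglu, by ultrafilters: along an ultrafilter every evaluation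
    converges, and the pointwise limit is again a functional in the ball. *)
Lemma ball_compact : compact [set: B].
Proof.
rewrite compact_ultra => F UF _ /=.
have lim_ex x : exists l : R, `|l| <= `|x| /\ ev g x @[g --> F] --> (l : R^o).
  have /= := @segment_compact R (- `|x|) `|x| (ev^~ x @ F) _ _.
  move=> []; first by
    apply: filterS filterT => g _ /=; rewrite in_itv /= -ler_norml ev_le.
  move=> l [/= lx lF]; exists l; split.
    by rewrite ler_norml; rewrite in_itv in lx.
  move=> V lV; have [//|FV] := in_ultra_setVsetC (ev^~ x @^-1` V) UF.
  have [|y [+ Vy]] := lF (~` V) V _ lV; first exact: FV.
  by [].
have [L LP] := choice lim_ex.
have [||b bL] := @ball_of_linear _ _ L.
- move=> a x y.
  apply: (@cvg_unique _ (@norm_hausdorff _ R^o) (ev^~ (a *: x + y) @ F)).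
    by have [] := LP (a *: x + y).
  rewrite (_ : ev^~ _ = fun g : B => a * ev g x + ev g y); last first.
    by apply/funext => g; rewrite evD evZ.
  apply: (@cvgD _ R^o); last by have [] := LP y.
  by apply: cvgMl_tmp; have [] := LP x.
- by move=> x; have [] := LP x.
by exists b; split => //; apply/ball_cvgP => x; rewrite bL; have [] := LP x.
Qed.

End BallTopology.

(** * The Hahn-Banach theorem for the norm *)

Section HahnBanach.
Context {R : realType} {X : normedModType R}.
Implicit Types (x y z : X) (p q : X -> R).

(** Homogeneity is only required as an inequality, which is easier to preserve
    under infima; equality follows. *)
Definition sublinear p :=
  (forall x y, p (x + y) <= p x + p y) /\
  (forall (a : R) x, 0 <= a -> p (a *: x) <= a * p x).

Lemma sublinear0 p : sublinear p -> p 0 = 0.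
Proof.
move=> [pD pZ]; apply/eqP; rewrite eq_le.
have := pZ 0 0 (lexx _); rewrite scale0r mul0r => ->.
by have := pD 0 0; rewrite addr0; lra.
Qed.

Lemma sublinear_opp_ge p x : sublinear p -> - p x <= p (- x).
Proof.
move=> sp; have [pD _] := sp; have := pD x (- x).
by rewrite subrr sublinear0//; lra.
Qed.

Lemma sublinear_inf (I : Type) (D : set I) (f : I -> X -> R) (m : X -> R) :
  D !=set0 -> (forall i x, D i -> m x <= f i x) ->
  (forall i j x y, D i -> D j ->
    exists2 k, D k & f k (x + y) <= f i x + f j y) ->
  (forall i a x, D i -> 0 <= a ->
    exists2 k, D k & f k (a *: x) <= a * f i x) ->
  sublinear (fun x => inf [set f i x | i in D]).
Proof.
move=> [i0 Di0] mf fD fZ.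
have lb x : has_lbound [set f i x | i in D].
  by exists (m x) => _ [i Di <-]; exact: mf.
have ne x : [set f i x | i in D] !=set0 by exists (f i0 x), i0.
split=> [x y|a x a0].
  rewrite -lerBlDr; apply: lb_le_inf => // _ [i Di <-].
  rewrite lerBlDr [f i x + _]addrC -lerBlDr; apply: lb_le_inf => // _ [j Dj <-].
  rewrite lerBlDr; have [k Dk] := fD i j x y Di Dj.
  rewrite [f j y + _]addrC; apply: le_trans; apply: ge_inf => //; by exists k.
have H i : D i -> inf [set f i (a *: x) | i in D] <= a * f i x.
  move=> Di; have [k Dk] := fZ i a x Di a0.
  by apply: le_trans; apply: ge_inf => //; exists k.
move: a0; rewrite le_eqVlt => /predU1P[a0|a0].
  by have := H i0 Di0; rewrite -a0 !mul0r.
rewrite mulrC -ler_pdivrMr//; apply: lb_le_inf => // _ [i Di <-].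
by rewrite ler_pdivrMr// mulrC; exact: H.
Qed.

(** The tilt of [p] is at most [- p a] at [- a]: a linear functional below it
    has value at least [p a] at [a]. *)
Definition sublinear_tilt p a : X -> R :=
  fun y => inf [set p (y + t *: a) - t * p a | t in [set t : R | 0 <= t]].

Lemma sublinear_tiltP p a : sublinear p ->
  [/\ sublinear (sublinear_tilt p a), forall y, sublinear_tilt p a y <= p y &
      sublinear_tilt p a (- a) <= - p a].
Proof.
move=> sp; have [pD pZ] := sp.
have m t y : 0 <= t -> - p (- y) <= p (y + t *: a) - t * p a.
  move=> t0; have h : t * p a <= p (t *: a).
    move: t0; rewrite le_eqVlt => /predU1P[<-|t0].
      by rewrite mul0r scale0r sublinear0.
    rewrite -ler_pdivlMl//; have := pZ t^-1 (t *: a).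
    by rewrite scalerA mulVf ?gt_eqF// scale1r invr_ge0 ltW//; exact.
  have := pD (y + t *: a) (- y); rewrite addrAC subrr add0r; lra.
have le t y : 0 <= t -> sublinear_tilt p a y <= p (y + t *: a) - t * p a.
  move=> t0; apply: ge_inf; last by exists t.
  by exists (- p (- y)) => _ [s /= s0 <-]; exact: m.
split.
- apply: (@sublinear_inf _ _ _ (fun y => - p (- y))).
  + by exists 0 => /=.
  + by move=> t y /= t0; exact: m.
  + move=> s t x y /= s0 t0; exists (s + t) => /=; first exact: addr_ge0.
    have := pD (x + s *: a) (y + t *: a).
    by rewrite addrACA -scalerDl; lra.
  + move=> t c y /= t0 c0; exists (c * t) => /=; first exact: mulr_ge0.
    have := pZ c (y + t *: a) c0.
    by rewrite scalerDr scalerA; lra.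
- by move=> y; have := le 0 y (lexx _); rewrite scale0r addr0 mul0r subr0.
- have := le 1 (- a) ler01.
  by rewrite scale1r addNr sublinear0// mul1r sub0r.
Qed.

(** A minimal sublinear functional, given by Zorn's lemma, is linear: tilting
    it in any direction cannot decrease it, which makes it odd. *)
Lemma sublinear_ge_linear q : sublinear q ->
  exists h : X -> R, linear (h : X -> R^o) /\ forall x, h x <= q x.
Proof.
move=> sq.
pose T := {p : X -> R | sublinear p /\ forall x, p x <= q x}.
pose le (p r : T) := `[< forall x, sval r x <= sval p x >].
have [|||A totA|[p [sp pq]] pmin] := @Zorn T le.
- by move=> p; apply/asboolP.
- move=> r s t /asboolP rs /asboolP st; apply/asboolP => x.
  exact: le_trans (rs x).
- move=> r s /asboolP rs /asboolP sr; apply: eq_sig_hprop.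
    by move=> p u v; exact: Prop_irrelevance.
  by apply/funext => x; apply/eqP; rewrite eq_le rs sr.
- have [A0|/set0P[r Ar]] := eqVneq A set0.
    by exists (exist _ q (conj sq (fun=> lexx _))) => s; rewrite A0.
  have mlb (s : T) x : A s -> - q (- x) <= sval s x.
    move=> _; case: s => s [ss sq'] /=.
    have := sublinear_opp_ge (- x) ss; rewrite opprK => /(le_trans _); apply.
    by rewrite lerN2.
  have sI : sublinear (fun x => inf [set sval s x | s in A]).
    apply: (@sublinear_inf _ _ _ (fun y => - q (- y))) => //.
    + by exists r.
    + move=> s t x y As At.
      have [/asboolP h|/asboolP h] := totA _ _ As At.
        exists t => //; have [+ _] := (svalP t).1; move=> /(_ x y).
        by move=> /le_trans; apply; rewrite lerD2r.
      exists s => //; have [+ _] := (svalP s).1; move=> /(_ x y).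
      by move=> /le_trans; apply; rewrite lerD2l.
    + move=> s a x As a0; exists s => //.
      by have [_ +] := (svalP s).1; exact.
  have Ile s x : A s -> inf [set sval s x | s in A] <= sval s x.
    move=> As; apply: ge_inf; last by exists s.
    by exists (- q (- x)) => _ [t At <-]; exact: mlb.
  unshelve eexists.
    exists (fun x => inf [set sval s x | s in A]); split=> // x.
    by apply: le_trans (Ile r x Ar) _; have [_] := svalP r.
  by move=> s As; apply/asboolP => x /=; exact: Ile.
have odd x : p (- x) = - p x.
  apply/eqP; rewrite eq_le sublinear_opp_ge// andbT.
  have [st tp] := sublinear_tiltP x sp.
  have tq y : sublinear_tilt p x y <= q y by exact: le_trans (tp y) (pq y).
  have E : exist _ _ (conj st tq) = exist _ p (conj sp pq) :> T.
    by apply: pmin; apply/asboolP.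
  by move: tp; have [-> _] := E.
have [pD pZ] := sp.
have addp x y : p (x + y) = p x + p y.
  apply/eqP; rewrite eq_le pD /=.
  by have := pD (x + y) (- y); rewrite addrK odd; lra.
have scp a x : 0 <= a -> p (a *: x) = a * p x.
  move=> a0; apply/eqP; rewrite eq_le pZ //=.
  have := pZ a (- x) a0; rewrite scalerN !odd; lra.
exists p; split => // a x y; rewrite addp; congr (_ + _).
have [/scp//|/ltW a0] := leP 0 a.
rewrite -[a]opprK scaleNr odd scp ?oppr_ge0//.
by rewrite scaleNr.
Qed.

(** Any linear functional below the tilt of the norm in the direction [x]
    attains its norm at [x]. *)
Lemma norm_attained x : exists b : set_type (dual_ball X), ev b x = `|x|.
Proof.
have sn : sublinear (fun y : X => `|y|).
  split=> [y z|a y a0]; first exact: ler_normD.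
  by rewrite normrZ ger0_norm.
have [sq qn qx] := sublinear_tiltP x sn.
have [h [lh hq]] := sublinear_ge_linear sq.
pose H : {linear X -> R^o} := HB.pack (h : X -> R^o)
  (GRing.isLinear.Build _ _ _ _ (h : X -> R^o) lh).
have hN y : h (- y) = - h y by exact: (linearN H).
have hle y : h y <= `|y| by exact: le_trans (qn y).
have [|b bh] := @ball_of_linear _ _ _ lh.
  by move=> y; rewrite ler_norml hle andbT lerNl -hN -normrN.
exists b; rewrite bh; apply/eqP; rewrite eq_le hle -lerN2 -hN.
exact: le_trans (hq _) qx.
Qed.

End HahnBanach.

(** * Nearest points of compact convex sets of functionals *)

Lemma closure_normP {R : realType} {V : normedModType R} (A : set V) (y : V) :
  closure A y <-> forall e : R, 0 < e -> exists2 c, A c & `|y - c| < e.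
Proof.
split=> [Ay e e0|H U /nbhs_ballP[e /= e0 eU]].
  by have [c [Ac]] := Ay _ (nbhsx_ballx y e e0); rewrite -ball_normE; exists c.
have [c Ac yc] := H e e0; exists c; split=> //; apply: eU.
by rewrite -ball_normE.
Qed.

Section RationalSubspace.
Context {R : realType} {V : normedModType R}.
Variable C : set V.
Hypotheses (C0 : C 0)
  (CD : forall c d (q : rat), C c -> C d -> C (c + ratr q *: d)).

Lemma closure_ratD y z : closure C y -> closure C z -> closure C (y + z).
Proof.
move=> /closure_normP yC /closure_normP zC; apply/closure_normP => e e0.
have e2 : 0 < e / 2 by lra.
have [c Cc yc] := yC _ e2; have [d Cd zd] := zC _ e2.
exists (c + ratr 1 *: d); first exact: CD.
rewrite rmorph1 scale1r opprD addrACA [e]splitr.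
by rewrite (le_lt_trans (ler_normD _ _))// ltrD.
Qed.

Lemma closure_ratZ (a : R) y : closure C y -> closure C (a *: y).
Proof.
move=> /closure_normP yC; apply/closure_normP => e e0.
have a1 : 0 < `|a| + 1 by rewrite ltr_wpDl.
have [c Cc yc] := yC (e / 2 / (`|a| + 1)) ltac:(by rewrite !divr_gt0).
have c1 : 0 < `|c| + 1 by rewrite ltr_wpDl.
have d0 : 0 < e / 2 / (`|c| + 1) by rewrite !divr_gt0.
have [q] := @rat_in_itvoo _ (a - e / 2 / (`|c| + 1)) (a + e / 2 / (`|c| + 1))
  ltac:(lra).
rewrite in_itv /= => aq; exists (0 + ratr q *: c); first exact: CD.
rewrite add0r (_ : _ - _ = a *: (y - c) + (a - ratr q) *: c); last first.
  by rewrite scalerBr scalerBl addrA subrK.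
rewrite (le_lt_trans (ler_normD _ _))// !normrZ [e]splitr ltr_leD//.
  rewrite (@le_lt_trans _ _ ((`|a| + 1) * `|y - c|)) ?ler_wpM2r//; first lra.
  by rewrite mulrC -ltr_pdivlMr.
rewrite (@le_trans _ _ (`|a - ratr q| * (`|c| + 1))) ?ler_wpM2l//; first lra.
by rewrite -ler_pdivlMr// ler_norml; lra.
Qed.

Lemma closure_ratB y z : closure C y -> closure C z -> closure C (y - z).
Proof.
by move=> Cy Cz; rewrite -scaleN1r; apply: closure_ratD => //; exact: closure_ratZ.
Qed.

End RationalSubspace.

Section NearestPoint.
Context {R : realType} {X : normedModType R}.
Local Notation B := (set_type (dual_ball X)).

(** For closed sets this amounts to convexity, and unlike convexity it can be
    arranged for a countable set. *)
Definition midpoint_closed (F : set B) := forall f g, F f -> F g ->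
  exists2 h, F h & forall x, ev h x = (ev f x + ev g x) / 2.

Lemma midpoint_closure (F : set B) :
  midpoint_closed F -> midpoint_closed (closure F).
Proof.
move=> Fm f g /closure_ballP Ff /closure_ballP Fg.
have [||h hE] := @ball_of_linear _ _ (fun x => (ev f x + ev g x) / 2).
- move=> a x y /=; rewrite !evD !evZ -[a *: _]/(a * _); lra.
- move=> x; rewrite normrM [`|2^-1|]ger0_norm// ler_pdivrMr//.
  rewrite (le_trans (ler_normD _ _))// mulr_natr mulr2n.
  by rewrite lerD// ev_le.
exists h; last by move=> x; rewrite hE.
apply/closure_ballP => E e e0.
have [f' Ff' f'E] := Ff E e e0; have [g' Fg' g'E] := Fg E e e0.
have [m Fm' mE] := Fm _ _ Ff' Fg'; exists m => // x xE.
rewrite hE mE; have := f'E _ xE; have := g'E _ xE.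
rewrite !ltr_norml; lra.
Qed.

Lemma dyadic_point (K : set B) f g n : midpoint_closed K -> K f -> K g ->
  exists2 h, K h & forall x, ev h x = ev f x + 2^-1 ^+ n * (ev g x - ev f x).
Proof.
move=> Km Kf Kg; elim: n => [|n [h Kh hE]].
  by exists g => // x; rewrite expr0; ring.
have [m Km' mE] := Km _ _ Kf Kh; exists m => // x.
by rewrite mE hE exprS; field.
Qed.

Lemma continuous_sqdist (r : seq (X * R)) : continuous
  (fun b : B => \sum_(p <- r) (p.2 - ev b p.1) ^+ 2 : R^o).
Proof.
set S := fun (r : seq (X * R)) (b : B) =>
  \sum_(p <- r) (p.2 - ev b p.1) ^+ 2 : R^o.
suff : continuous (S r) by []; elim: r => [|p r IHr].
  have -> : S [::] = cst 0 by apply/funext => c; rewrite /S big_nil.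
  by move=> b; refine (@cvg_cst _ _ _ _ _); exact: nbhs_filter.
have -> : S (p :: r) = (fun c => (p.2 - ev c p.1) * (p.2 - ev c p.1)) \+ S r.
  by apply/funext => c; rewrite /S big_cons expr2.
move=> b; apply: (@cvgD _ R^o); [exact: nbhs_filter| |exact: IHr].
have H : p.2 - ev c p.1 @[c --> b] --> (p.2 - ev b p.1 : R^o).
  by apply: (@cvgB _ R^o); [exact: nbhs_filter|
    refine (@cvg_cst _ _ _ _ _); exact: nbhs_filter|exact: ev_cvg].
exact: (cvgM H H).
Qed.

(** The variational inequality at the point [b] of [K] whose values at the
    vectors [p.1] are nearest, in the Euclidean sense, to the targets [p.2]. The
    segment from [b] to [g] is only available at dyadic times, but times tending
    to zero suffice. *)
Lemma nearest_point (K : set B) (r : seq (X * R)) :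
  K !=set0 -> compact K -> midpoint_closed K ->
  exists2 b, K b & let z := \sum_(p <- r) (p.2 - ev b p.1) *: p.1 in
    forall g, K g -> ev g z <= ev b z.
Proof.
move=> K0 cK Km.
have [|b Kb bmin] := @compact_EVT_min _ R
    (fun b : B => \sum_(p <- r) (p.2 - ev b p.1) ^+ 2) K K0 cK.
  by apply: continuous_subspaceT; exact: continuous_sqdist.
exists b; first by move: Kb; rewrite inE.
move=> z g Kg; rewrite inE in Kb.
set D := \sum_(p <- r) (ev g p.1 - ev b p.1) ^+ 2.
have D0 : 0 <= D by apply: sumr_ge0 => p _; exact: sqr_ge0.
have zE : ev g z - ev b z =
    \sum_(p <- r) (p.2 - ev b p.1) * (ev g p.1 - ev b p.1).
  rewrite !ev_sum -sumrB; apply: eq_bigr => p _.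
  by rewrite !evZ mulrBr.
have H n : 2 * (ev g z - ev b z) <= 2^-1 ^+ n * D.
  have [h Kh hE] := dyadic_point n Km Kb Kg.
  set t := 2^-1 ^+ n in hE *.
  have t0 : 0 < t by rewrite exprn_gt0// invr_gt0.
  have := bmin h; rewrite inE => /(_ Kh).
  have -> : \sum_(p <- r) (p.2 - ev h p.1) ^+ 2 =
     \sum_(p <- r) (p.2 - ev b p.1) ^+ 2 + t * (t * D - 2 * (ev g z - ev b z)).
    rewrite zE /D !mulr_sumr -sumrB mulr_sumr -big_split /=.
    by apply: eq_bigr => p _; rewrite hE; ring.
  by rewrite lerDl pmulr_rge0// subr_ge0.
rewrite leNgt; apply/negP => lt.
have [D00|Dn] := eqVneq D 0; first by have := H 0%N; rewrite D00; lra.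
have Dp : 0 < D by rewrite lt_def Dn.
have : 0 < 2 * (ev g z - ev b z) / D by rewrite divr_gt0//; lra.
move=> d0.
have : (2^-1 : R) ^+ n @[n --> \oo] --> (0 : R^o).
  by apply: cvg_expr; rewrite ger0_norm ?invr_ge0// invf_lt1//; lra.
move=> /cvgrPdist_lt/(_ _ d0)[N _ /(_ N (leqnn N))].
rewrite /= sub0r normrN ger0_norm ?exprn_ge0 ?invr_ge0//.
by rewrite ltr_pdivlMr// ltNge H.
Qed.

End NearestPoint.

(** * Projections from a norming, separating pair *)

Lemma harmonic_lt {R : realType} (e : R) : 0 < e ->
  exists N, forall n, (N <= n)%N -> n.+1%:R^-1 < e.
Proof.
move=> e0; have := @cvg_harmonic R => /cvgrPdist_lt/(_ _ e0)[N _ HN].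
exists N => n Nn; have := HN n Nn.
by rewrite /= /harmonic sub0r normrN ger0_norm ?invr_ge0.
Qed.

Section Projection.
Context {R : realType} {X : completeNormedModType R}.
Local Notation B := (set_type (dual_ball X)).
Variables (C : set X) (F : set B).
Hypotheses (C0 : C 0)
  (CD : forall c d (q : rat), C c -> C d -> C (c + ratr q *: d))
  (F0 : exists2 f, F f & forall x, ev f x = 0)
  (FN : forall f, F f -> exists2 g, F g & forall x, ev g x = - ev f x)
  (Fm : midpoint_closed F)
  (Fnorm : forall c (e : R), C c -> (forall f, F f -> `|ev f c| <= e) ->
     `|c| <= e)
  (Csep : forall f g, closure F f -> closure F g ->
     (forall c, C c -> ev f c = ev g c) -> f = g).

(** Norming passes to the closure because [F] is bounded by the norm. *)
Lemma norming_closure (y : X) (e : R) : closure C y ->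
  (forall f, F f -> `|ev f y| <= e) -> `|y| <= e.
Proof.
move=> /closure_normP Cy fy; apply/ler_addgt0Pr => d d0.
have d2 : 0 < d / 2 by lra.
have [c Cc yc] := Cy _ d2.
have : `|c| <= e + d / 2.
  apply: Fnorm => // f Ff; rewrite -[c](subrK y) evD.
  rewrite (le_trans (ler_normD _ _))// addrC lerD ?fy//.
  by rewrite (le_trans (ev_le _ _))// distrC ltW.
have := ler_normD (y - c) c; rewrite subrK; lra.
Qed.

(** Otherwise some functional in the closure of [F] has value [e] at [x] and
    vanishes on [C], against separation. *)
Lemma approx_projection (x : X) (e : R) : 0 < e ->
  exists2 y, closure C y & forall f, F f -> `|ev f (x - y)| <= e.
Proof.
move=> e0; apply: contrapT => /forall2NP H.
have far y : closure C y -> exists2 f, F f & e < `|ev f (x - y)|.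
  move=> Cy; have [//|/existsNP[f /not_implyP[Ff /negP]]] := H y.
  by rewrite -ltNge; exists f.
pose K := closure F; have [ze Fo o0] := F0.
have cK : compact K.
  by apply: subclosed_compact (@ball_compact R X) _ => //; exact: closed_closure.
have K0 : K !=set0 by exists ze; exact: subset_closure.
(* By compactness, finitely many vectors of [C] already witness that no member
   of [K] with value [e] at [x] vanishes on [C]. *)
have [E EC Ecov] : exists2 E : seq X, (forall c, c \in E -> C c) &
    forall b, K b -> ev b x <> e \/ exists2 c, c \in E & ev b c <> 0.
  pose G := filter_from [set E : seq X | forall c, c \in E -> C c]
    (fun E0 : seq X => [set E : seq X | {subset E0 <= E}]).
  have FG : Filter G.
    apply: filter_from_filter; first by exists [::].
    move=> E1 E2 /= E1C E2C; exists (E1 ++ E2) => /=.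
      by move=> c; rewrite mem_cat => /orP[/E1C|/E2C].
    by move=> E sE; split=> c cE; apply: sE; rewrite mem_cat cE ?orbT.
  pose P (E : seq X) (b : B) := ev b x <> e \/ exists2 c, c \in E & ev b c <> 0.
  have near_ne (z : X) (t : R) (b : B) : ev b z <> t ->
      \forall b' \near b, ev b' z <> t.
    move=> bt; have bt0 : 0 < `|ev b z - t| by rewrite normr_gt0 subr_eq0; apply/eqP.
    have /cvgrPdist_lt/(_ _ bt0) := @ev_cvg _ _ b z.
    by apply: filterS => b' /= + b't; rewrite b't ltxx.
  have /compact_near_coveringP/(_ _ G P FG) := cK.
  case=> [b Kb|E EC sE]; last by exists E => //; exact: sE.
  have [bx|bx] := pselect (ev b x = e); last first.
    exists ([set b' | ev b' x <> e], setT) => /=; last first.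
      by move=> [b' E] /= [? _]; left.
    by split; [exact: near_ne|exact: filterT].
  have [c Cc bc] : exists2 c, C c & ev b c <> 0.
    apply: contrapT => /forall2NP bC.
    have bo : b = ze.
      apply: Csep => //; first exact: subset_closure.
      by move=> c Cc; rewrite o0; have [//|/contrapT] := bC c.
    by move: e0; rewrite -bx bo o0 ltxx.
  exists ([set b' | ev b' c <> 0], [set E : seq X | c \in E]) => /=.
    split; first exact: near_ne.
    by exists [:: c] => [|E /= sE]; [move=> d /[!inE]/eqP->|apply: sE; rewrite inE].
  by move=> [b' E] /= [? ?]; right; exists c.
pose r := (x, e) :: [seq (c, 0) | c <- E].
have [b Kb] := nearest_point r K0 cK (midpoint_closure Fm).
rewrite /r big_cons big_map /= -/(_ - _).
set a := e - ev b x; set w := \sum_(c <- E) _ => bz.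
have wE : w = - \sum_(c <- E) ev b c *: c.
  by rewrite -sumrN; apply: eq_bigr => c _; rewrite sub0r scaleNr.
have Cw : closure C w.
  rewrite wE -scaleN1r; apply: closure_ratZ => //.
  rewrite big_seq; elim/big_ind : _ => [||c cE]; first exact: subset_closure.
  - exact: closure_ratD.
  - by apply: closure_ratZ => //; apply: subset_closure; exact: EC.
have bzE : ev b (a *: x + w) = a * e - a ^+ 2 - \sum_(c <- E) ev b c ^+ 2.
  rewrite evD evZ wE evN ev_sum; congr (_ - _); last first.
    by apply: eq_bigr => c _; rewrite evZ expr2.
  by rewrite /a; ring.
have S0 : 0 <= \sum_(c <- E) ev b c ^+ 2 by apply: sumr_ge0 => c _; exact: sqr_ge0.
(* If [a = 0] the comparison with the zero functional shows that [b] meets all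
   targets, contradicting the choice of [E]. *)
have [a0|an] := eqVneq a 0.
  have := bz ze (subset_closure Fo); rewrite o0 bzE a0 mul0r expr0n subr0 sub0r.
  rewrite oppr_ge0 => S0'.
  have /eqP : \sum_(c <- E) ev b c ^+ 2 = 0 by apply/eqP; rewrite eq_le S0'.
  rewrite psumr_eq0; last by move=> c _; exact: sqr_ge0.
  move=> /allP bE; have [|[c /bE]] := Ecov b Kb.
    by apply; apply/eqP; rewrite eq_sym -subr_eq0; apply/eqP.
  by rewrite /= sqrf_eq0 => /eqP.
(* Otherwise [a *: x + w] is [a] times the difference between [x] and a point of the
   closure of [C], so some member of [F] is too large there. *)
have Cy : closure C (- a^-1 *: w) by exact: closure_ratZ.
have [f Ff fe] := far _ Cy.
have zE : a *: x + w = a *: (x - - a^-1 *: w).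
  by rewrite scalerBr scalerA mulrN divff// scaleN1r opprK.
have [g Fg gz] : exists2 g, F g & ev g (a *: x + w) = `|ev f (a *: x + w)|.
  have [/ger0_norm->|/ltr0_norm->] := leP 0 (ev f (a *: x + w)); first by exists f.
  by have [g Fg gE] := FN Ff; exists g.
have := bz g (subset_closure Fg); rewrite gz bzE zE evZ normrM.
have := ler_norm (a * e); rewrite normrM (gtr0_norm e0).
have := sqr_ge0 a.
have : `|a| * e < `|a| * `|ev f (x - - a^-1 *: w)|.
  by rewrite ltr_pM2l// normr_gt0.
lra.
Qed.

(** The approximations form a Cauchy sequence since [F] norms their
    differences. *)
Lemma exists_projection_point (x : X) :
  exists2 y, closure C y & forall f, F f -> ev f y = ev f x.
Proof.
have H n : exists y, closure C y /\ forall f, F f -> `|ev f (x - y)| <= n.+1%:R^-1.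
  by have [|y Cy fy] := @approx_projection x n.+1%:R^-1; [rewrite invr_gt0|exists y].
have [u uP] := choice H.
have uu k m : `|u k - u m| <= k.+1%:R^-1 + m.+1%:R^-1.
  have [Cn fn] := uP k; have [Cm fm] := uP m.
  apply: norming_closure; first exact: closure_ratB.
  move=> f Ff; rewrite (_ : u k - u m = (x - u m) - (x - u k)); last first.
    by rewrite opprB [RHS]addrC addrA subrK.
  rewrite evB (le_trans (ler_normB _ _))// addrC lerD//; [exact: fn|exact: fm].
have : cauchy (u @ \oo).
  apply: cauchy_exP => e e0; have e2 : 0 < e / 2 by lra.
  have [N HN] := harmonic_lt e2; exists (u N); exists N => // n /= Nn.
  rewrite -ball_normE /=; apply: le_lt_trans (uu N n) _.
  by rewrite [e]splitr ltrD ?HN.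
move=> /cauchy_cvg/cvg_ex[/= y uy].
have yd (e : R) : 0 < e -> exists N, forall n, (N <= n)%N -> `|y - u n| < e.
  by move=> e0; move/cvgrPdist_lt : uy => /(_ _ e0)[N _ HN]; exists N.
exists y.
  apply: closed_cvg uy; first exact: closed_closure.
  by apply: nearW => n; have [] := uP n.
move=> f Ff; apply/eqP; rewrite eq_sym -subr_eq0 -normr_le0.
apply/ler_addgt0Pr => e e0; have e2 : 0 < e / 2 by lra.
have [N HN] := harmonic_lt e2; have [M HM] := yd _ e2; pose n := (N + M)%N.
rewrite add0r -evB (_ : x - y = (x - u n) - (y - u n)); last first.
  by rewrite opprB addrA subrK.
rewrite evB (le_trans (ler_normB _ _))// [e]splitr lerD//.
  by have [_ /(_ _ Ff)/le_trans] := uP n; apply; rewrite ltW// HN// leq_addr.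
by rewrite (le_trans (ev_le _ _))// ltW// HM// leq_addl.
Qed.

Lemma exists_projection : exists P : {linear X -> X},
  [/\ forall x, closure C (P x), forall f x, F f -> ev f (P x) = ev f x,
      forall x, `|P x| <= `|x| & forall y, closure C y -> P y = y].
Proof.
have [p pP] := choice (fun x => 
  let: ex_intro2 y a b := exists_projection_point x in ex_intro _ y (conj a b)).
have uniq y z : closure C y -> closure C z ->
    (forall f, F f -> ev f y = ev f z) -> y = z.
  move=> Cy Cz yz; apply/eqP; rewrite -subr_eq0 -normr_le0.
  apply: norming_closure; first exact: closure_ratB.
  by move=> f Ff; rewrite evB yz// subrr normr0.
have lp : linear p.
  move=> a x y; have [Cx fx] := pP x; have [Cy fy] := pP y.
  have [Cxy fxy] := pP (a *: x + y).
  apply: uniq => //; first by apply: closure_ratD => //; exact: closure_ratZ.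
  by move=> f Ff; rewrite fxy// !evD !evZ fx// fy.
pose P : {linear X -> X} := HB.pack p (GRing.isLinear.Build _ _ _ _ p lp).
exists P; split => /=.
- by move=> x; have [] := pP x.
- by move=> f x; have [_] := pP x; exact.
- move=> x; have [Cx fx] := pP x; apply: norming_closure => // f Ff.
  by rewrite fx// ev_le.
- by move=> y Cy; have [? ?] := pP y; exact: uniq.
Qed.

End Projection.

(** * Maps of the ball and countably many coordinates *)

Section Metrizability.
Context {R : realType} {X : normedModType R}.
Local Notation B := (set_type (dual_ball X)).

(** For each [e], compactness makes finitely many coordinates determine the
    image up to [e]: two functionals agreeing on these coordinates lie in a common
    basic neighbourhood on which the map varies by less than [e]. *)
Lemma countable_determining (r : B -> B) : continuous r ->
  metrizable R (set_type (range r)) ->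
  exists2 C : set X, countable C &
    forall f g, (forall c, C c -> ev f c = ev g c) -> r f = r g.
Proof.
move=> cr [d [d0 dE ds dt dn]].
have rr f : r f \in range r by apply/mem_set; exists f.
pose q f : set_type (range r) := SigSub (rr f).
have qnbhs f (e : R) : 0 < e -> nbhs f [set g | d (q f) (q g) < e].
  move=> e0; have : nbhs (q f) [set y | d (q f) y < e] by rewrite dn; exists e.
  rewrite nbhsE => -[_ [[V oV <-] Vf] sVU].
  apply: (@filterS _ _ _ (r @^-1` V)); first by move=> g /= Vg; apply: sVU.
  by apply: (cr f); exact: open_nbhs_nbhs.
have unif (e : R) : 0 < e -> exists E : seq X, forall f g,
    (forall x, x \in E -> ev f x = ev g x) -> d (q f) (q g) < e.
  move=> e0; have e2 : 0 < e / 2 by lra.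
  pose G := filter_from setT
    (fun E0 : seq X => [set E : seq X | {subset E0 <= E}]).
  have FG : Filter G.
    apply: filter_from_filter; first by exists [::].
    move=> E1 E2 _ _; exists (E1 ++ E2) => //.
    by move=> E sE; split=> c cE; apply: sE; rewrite mem_cat cE ?orbT.
  pose P (E : seq X) (f : B) := forall g,
    (forall x, x \in E -> ev f x = ev g x) -> d (q f) (q g) < e.
  have /compact_near_coveringP/(_ _ G P FG) := @ball_compact R X.
  case=> [f _|E _ sE]; last by exists E => f g; exact: sE.
  have [E [t t0 EU]] := ball_basis (qnbhs f _ e2).
  exists ([set g | forall x, x \in E -> `|ev f x - ev g x| < t],
          [set E' : seq X | {subset E <= E'}]) => /=.
    by split; [exact: nbhs_basic|exists E].
  move=> [f' E'] /= [f'E sE] g gE.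
  have h1 : d (q f) (q f') < e / 2 by exact: EU.
  have h2 : d (q f) (q g) < e / 2.
    by apply: EU => x xE; rewrite -gE; [exact: f'E|exact: sE].
  rewrite (le_lt_trans (dt _ (q f) _))// [d _ (q f)]ds [e]splitr ltrD//.
have [E EP] := choice (fun n => unif n.+1%:R^-1 ltac:(by rewrite invr_gt0)).
exists (\bigcup_n [set` E n]).
  by apply: bigcup_countable => // n _; exact/finite_set_countable/finite_seq.
move=> f g fg; apply: (congr1 set_val (_ : q f = q g)); apply/dE/eqP.
rewrite eq_le d0 andbT; apply/ler_addgt0Pr => e e0.
rewrite add0r; have [N HN] := harmonic_lt e0.
apply/ltW/(lt_trans _ (HN N (leqnn _)))/EP => x xE; apply: fg.
by exists N.
Qed.

(** Pointwise convergence on the sequence [c] already forces pointwise convergence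
    everywhere, as all the functionals are 1-Lipschitz. Truncating the n-th
    difference at [n.+1^-1] makes the uniform distance along [c] metrize it. *)
Lemma metrizable_of_countable (K : set B) (c : nat -> X) :
  (forall x, exists2 y, closure (range c) y & forall f, K f -> ev f x = ev f y) ->
  metrizable R (set_type K).
Proof.
move=> KC; pose w (n : nat) : R := n.+1%:R^-1.
have w0 n : 0 < w n by rewrite invr_gt0.
pose t (f g : set_type K) n :=
  Num.min (w n) `|ev (set_val f) (c n) - ev (set_val g) (c n)|.
pose d f g := sup (range (t f g)).
have t0 f g n : 0 <= t f g n by rewrite le_min normr_ge0 ltW.
have tw f g n : t f g n <= w n by rewrite ge_min lexx.
have tC f g : t f g = t g f by apply: funext => n; rewrite /t distrC.
have td f g n : t f g n <= d f g.
  apply: ub_le_sup; last by exists n.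
  exists 1 => _ [m _ <-]; apply: le_trans (tw _ _ _) _.
  by rewrite invf_le1// ler1n.
have dle f g e : (forall n, t f g n <= e) -> d f g <= e.
  move=> te; apply: ge_sup; first by exists (t f g 0%N), 0%N.
  by move=> _ [n _ <-].
have small (k : set_type K) x (e : R) : 0 < e -> exists2 s, 0 < s & forall g,
    d k g < s -> `|ev (set_val k) x - ev (set_val g) x| < e.
  move=> e0; have [y yc yx] := KC x; have e3 : 0 < e / 3 by lra.
  have [_ [[n _ <-]]] := yc _ (nbhsx_ballx y (e / 3) e3).
  rewrite -ball_normE /= => yn.
  exists (Num.min (w n) (e / 3)); first by rewrite lt_min w0.
  move=> g /(le_lt_trans (td k g n)).
  rewrite /t gt_min lt_min ltxx /= lt_min => /andP[_ kg].
  rewrite (_ : _ - _ = (ev (set_val k) (y - c n) - ev (set_val g) (y - c n)) +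
    (ev (set_val k) (c n) - ev (set_val g) (c n))); last first.
    by rewrite !evB !yx; [ring|exact: set_valP|exact: set_valP].
  have := ler_normD (ev (set_val k) (y - c n) - ev (set_val g) (y - c n))
    (ev (set_val k) (c n) - ev (set_val g) (c n)).
  have := ler_normB (ev (set_val k) (y - c n)) (ev (set_val g) (y - c n)).
  have := ev_le (set_val k) (y - c n); have := ev_le (set_val g) (y - c n).
  lra.
exists d; split.
- by move=> f g; exact: le_trans (td f g 0%N).
- move=> f g; split=> [fg|->]; last first.
    apply/eqP; rewrite eq_le (le_trans (t0 g g 0%N) (td _ _ _)) andbT.
    by apply: dle => n; rewrite /t subrr normr0 ge_min lexx orbT.
  apply: val_inj; apply: ev_inj => x; apply/eqP; rewrite -subr_eq0 -normr_le0.
  apply/ler_addgt0Pr => e e0; rewrite add0r ltW//.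
  by have [s s0] := small f x e e0; apply; rewrite fg.
- by move=> f g; rewrite /d tC.
- move=> f g h; apply: dle => n.
  have := ler_distD (ev (set_val g) (c n)) (ev (set_val f) (c n))
    (ev (set_val h) (c n)).
  have := td f g n; have := td g h n; have := t0 f g n; have := t0 g h n.
  rewrite /t !(ge_min, le_min) /Num.min.
  by do 2![case: ltP]; move: (w0 n); case: ltP; lra.
move=> k; apply/seteqP; split=> U.
- move=> /sub_ball_basis[E [e e0 EU]].
  have [s s0 sE] : exists2 s, 0 < s & forall g, d k g < s ->
      forall x, x \in E -> `|ev (set_val k) x - ev (set_val g) x| < e.
    elim: (E) => [|x E' [s s0 IH]]; first by exists 1.
    have [s' s'0 H] := small k x e e0.
    exists (Num.min s s') => [|g]; first by rewrite lt_min s0.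
    rewrite lt_min => /andP[gs gs'] y; rewrite inE => /predU1P[->|]; first exact: H.
    exact: IH.
  by exists s => // g /= gs; apply: EU; exact: sE.
- move=> [e /= e0 eU]; apply/sub_ball_basis.
  have e2 : 0 < e / 2 by lra.
  have [N HN] := harmonic_lt e2.
  exists [seq c n | n <- iota 0 N], (e / 2) => // g gE; apply: eU => /=.
  rewrite (@le_lt_trans _ _ (e / 2))//; last lra.
  apply: dle => n; have [Nn|nN] := leqP N n.
    by rewrite (le_trans (tw _ _ _))// ltW// HN.
  rewrite /t ge_min; apply/orP; right; apply/ltW/gE/map_f.
  by rewrite mem_iota.
Qed.

End Metrizability.

(** * From projections to retractions *)

Section AdjointRetractions.
Context {R : realType} {X : normedModType R}.
Local Notation B := (set_type (dual_ball X)).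

Lemma countable_range (T : Type) (C : set T) : countable C -> C !=set0 ->
  exists c : nat -> T, range c = C.
Proof.
move=> /pfcard_geP[->[]//|/unsquash c _].
by exists c; exact: image_eq.
Qed.

Lemma up_filter_filter d (G : porderType d) (s0 : G) :
  up_directed G -> Filter (up_filter G).
Proof.
move=> Gdir; apply: filter_from_filter; first by exists s0.
move=> s t _ _; have [u [su tu]] := Gdir s t; exists u => // v /= uv.
by split; exact: le_trans uv.
Qed.

(** Each axiom is the transposed one, for the retractions sending [f] to
    [f \o P s]. *)
Lemma adjoint_retractional_skeleton (D : set (dual X)) :
  induced_by_projectional_skeleton 1 D ->
  induced_by_retractional_skeleton R (to_ball D).
Proof.
move=> [d [G [P [[[Gdir Gsig Pbd PP Psep Pcov Pcomp Psup] Pn] ->]]]].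
have P1 s x : `|P s x| <= `|x|.
  by have [h _] := opnorm_le1 (Pbd s); exact: h (Pn s) x.
have /choice[r0 r0E] : forall p : G * B, exists b : B, ev b = ev p.2 \o P p.1.
  move=> [s b]; apply: ball_of_linear.
    by move=> a x y; rewrite /= linearP evD evZ.
  by move=> x /=; rewrite (le_trans (ev_le _ _)).
pose r s b := r0 (s, b).
have rE s b x : ev (r s b) x = ev b (P s x) by rewrite /r r0E.
exists d, G, r; split; last first.
  apply/seteqP; split=> [b [s _ [f bf]]|_ [s _ [b _ <-]]].
    exists s => //; exists b => //; apply: ev_inj => x.
    by rewrite rE {1}/ev bf PP -bf.
  exists s => //; exists (set_val b) => x; exact: rE.
split=> //.
- move=> s b; have cP x : ev (r s g) x @[g --> b] --> (ev (r s b) x : R^o).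
    rewrite rE (_ : (fun g => _) = ev^~ (P s x)); last first.
      by apply: funext => g; rewrite rE.
    exact: ev_cvg.
  apply/ball_cvgP; first by apply: fmap_filter; exact: nbhs_filter.
  exact: cP.
- by move=> s b; apply: ev_inj => x; rewrite !rE PP.
- move=> s; have [C [cC Cs sC]] := Psep s.
  have [|c cE] := countable_range cC.
    have [y [Cy _]] := sC _ (imageT (P s) 0) _ (nbhsx_ballx _ 1 ltr01).
    by exists y.
  apply: (@metrizable_of_countable _ _ _ c) => x; exists (P s x).
    by rewrite cE; apply: sC; exists x.
  by move=> _ [b _ <-]; rewrite !rE PP.
- move=> b.
  have [s0 _ _] : (\bigcup_s range (P s)) 0 by rewrite Pcov.
  have FG := up_filter_filter s0 Gdir.
  apply/ball_cvgP => x; apply/cvgrPdist_lt => e e0.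
  have [s _ [z _ zx]] : (\bigcup_s range (P s)) x by rewrite Pcov.
  exists s => // t st /=; rewrite rE -zx.
  by rewrite -(Pcomp s t st z).2 subrr normr0.
- move=> s t st b; split; apply: ev_inj => x; rewrite !rE;
    by have [? ?] := Pcomp s t st x; congr (ev b _).
- move=> u t incu lubt b.
  apply/ball_cvgP => x; apply/cvgrPdist_lt => e e0.
  have e2 : 0 < e / 2 by lra.
  have [y [[N _ yN] Px]] : (\bigcup_n range (P (u n)) `&` ball (P t x) (e / 2)) !=set0.
    have : range (P t) (P t x) by exists x.
    by rewrite (Psup u t incu lubt) => /(_ _ (nbhsx_ballx _ _ e2)).
  move: Px; rewrite -ball_normE /= => Px.
  exists N => // n /= Nn; rewrite !rE -evB.
  apply: le_lt_trans (ev_le _ _) _.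
  have unt : (u n <= t)%O by apply: lubt.1; exists n.
  have -> : P t x - P (u n) x = (P t x - y) - P (u n) (P t x - y).
    rewrite linearB /= -(Pcomp _ _ unt x).1.
    have -> : P (u n) y = y; last by rewrite opprB addrA subrK.
    move: yN => [z _ <-].
    have uNn : (u N <= u n)%O by rewrite incu.
    by rewrite -(Pcomp _ _ uNn z).2.
  rewrite (le_lt_trans (ler_normB _ _))// [e]splitr ltrD//.
  exact: le_lt_trans Px.
Qed.

End AdjointRetractions.

(** * Limits in a retractional skeleton *)

Section SkeletonLimits.
Context {R : realType} {X : normedModType R}.
Local Notation B := (set_type (dual_ball X)).
Context {d : Order.disp_t} {G : porderType d}.
Variable r : G -> B -> B.
Hypothesis rs : retractional_skeleton R r.

Lemma range_retraction_le s t : (s <= t)%O -> range (r s) `<=` range (r t).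
Proof.
move=> st _ [f _ <-]; exists (r s f) => //.
by rewrite -(rs_compat rs st f).2.
Qed.

(** The range of a retraction of a Hausdorff space is closed. *)
Lemma closure_range_retraction s (F : set B) f :
  F `<=` range (r s) -> closure F f -> r s f = f.
Proof.
move=> Fr Ff; apply: ev_inj => x; apply/eqP; rewrite -subr_eq0 -normr_le0.
apply/ler_addgt0Pr => e e0; have e2 : 0 < e / 2 by lra.
have near_f := @nbhs_basic _ _ f [:: x] _ e2.
have near_rf := rs_continuous rs (nbhs_basic (r s f) [:: x] e2).
have [g [Fg [/= H1 H2]]] := Ff _ (filterI near_f near_rf).
have [h _ hg] := Fr _ Fg.
have := H1 x; have := H2 x; rewrite !inE eqxx -hg (rs_retraction rs).
move=> /(_ isT) + /(_ isT).
rewrite !ltr_norml ler_norml; lra.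
Qed.

(** The continuity axiom only speaks of strictly increasing sequences; a merely
    nondecreasing one is stationary or has a strictly increasing subsequence. *)
Lemma lub_retraction_agree (u : nat -> G) t f g :
  nondecreasing_seq u -> isLub (range u) t ->
  (forall n, r (u n) f = r (u n) g) -> r t f = r t g.
Proof.
move=> ndu [tub tlub] fg.
have [[N stat]|H] := pselect (exists N, forall m, (N <= m)%N -> (u m <= u N)%O).
  suff -> : t = u N by exact: fg.
  apply/eqP; rewrite eq_le andbC tub /=; last by exists N.
  apply: tlub => _ [m _ <-]; have [Nm|mN] := leqP N m; first exact: stat.
  exact/ndu/ltnW.
have /choice[nx nxP] : forall N, exists m, (N < m)%N /\ (u N < u m)%O.
  move=> N; apply: contrapT => /forallNP nolt; apply: H; exists N => m Nm.
  apply: contrapT => umN; apply: (nolt m).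
  have uNm : (u N < u m)%O.
    rewrite lt_neqAle ndu// andbT; apply/eqP => E; apply: umN.
    by rewrite E.
  split=> //; rewrite ltn_neqAle Nm andbT; apply/eqP => E.
  by move: uNm; rewrite E ltxx.
pose v k := u (iter k nx 0%N).
have iv : increasing_seq v.
  by apply/increasing_seqP => n; exact: (nxP _).2.
have it n : (n <= iter n nx 0)%N.
  by elim: n => // n IH; apply: leq_ltn_trans IH _; exact: (nxP _).1.
have lubv : isLub (range v) t.
  split=> [_ [n _ <-]|b bub]; first by apply: tub; exists (iter n nx 0%N).
  apply: tlub => _ [n _ <-]; apply: le_trans (ndu _ _ (it n)) _.
  by apply: bub; exists n.
apply: ev_inj => x.
have lim h : ev (r (v k) h) x @[k --> \oo] --> (ev (r t h) x : R^o).
  have /ball_cvgP : r (v k) h @[k --> \oo] --> r t h by exact: (rs_sup rs iv lubv).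
  exact.
apply: (cvg_unique (@norm_hausdorff _ R^o) (lim f)).
rewrite (_ : (fun k => _) = (fun k => ev (r (v k) g) x)); first exact: lim.
by apply: funext => k; rewrite /v fg.
Qed.

(** Directedness and countable completeness make the index set directed for
    countable families. *)
Lemma countable_absorbed (F : set B) s0 : countable F ->
  F `<=` \bigcup_s range (r s) -> exists2 s, (s0 <= s)%O & F `<=` range (r s).
Proof.
move=> cF FA; have [->|/set0P F0] := eqVneq F set0; first by exists s0.
have [c cE] := countable_range cF F0.
have /choice[sg sgP] : forall n, exists s, range (r s) (c n).
  by move=> n; have [|s _ cs] := FA (c n); [rewrite -cE; exists n|exists s].
have /choice[j jP] : forall p : G * G, exists w, (p.1 <= w)%O /\ (p.2 <= w)%O.
  by move=> [a b]; exact: rs_up_directed rs a b.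
pose v := fix v n := if n is m.+1 then j (v m, sg m) else s0.
have ndv : nondecreasing_seq v.
  by apply/nondecreasing_seqP => n; exact: (jP (v n, sg n)).1.
have [t [tub _]] := rs_sigma_complete rs ndv.
exists t; first by apply: tub; exists 0%N.
move=> f; rewrite -cE => -[n _ <-].
apply: (range_retraction_le _ (sgP n)); apply: le_trans (jP (v n, sg n)).2 _.
by apply: tub; exists n.+1.
Qed.

End SkeletonLimits.

(** * Closing off countable pieces *)

Lemma countableU (T : Type) (A C : set T) :
  countable A -> countable C -> countable (A `|` C).
Proof.
move=> cA cC; rewrite -bigcup2E; apply: bigcup_countable => // -[|[|n]] _ //=.
Qed.

Lemma countable_image (T U : Type) (f : T -> U) (A : set T) :
  countable A -> countable (f @` A).
Proof. by move=> cA; apply: sub_countable cA; exact: card_image_le. Qed.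

Section Pieces.
Context {R : realType} {X : normedModType R}.
Local Notation B := (set_type (dual_ball X)).
Context {d : Order.disp_t} {G : porderType d}.

(** Approximations to the members of the projectional skeleton: vectors whose
    closure is the range of the projection, functionals that define it, and a
    retraction whose range contains them. *)
Record piece := Piece { vecs : set X; funs : set B; stage : G }.

Implicit Types t w : piece.

Definition piece_le t w :=
  [/\ vecs t `<=` vecs w, funs t `<=` funs w & (stage t <= stage w)%O].

Lemma piece_le_refl t : piece_le t t. Proof. by split. Qed.

Lemma piece_le_trans u t w : piece_le t u -> piece_le u w -> piece_le t w.
Proof.
move=> [a1 a2 a3] [b1 b2 b3]; split; last exact: le_trans b3.
  exact: subset_trans b1.
exact: subset_trans b2.
Qed.

Lemma piece_le_anti t w : piece_le t w -> piece_le w t -> t = w.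
Proof.
case: t => ? ? ?; case: w => ? ? ? [/= a1 a2 a3] [/= b1 b2 b3].
congr Piece; [exact/seteqP|exact/seteqP|].
by apply/eqP; rewrite eq_le a3.
Qed.

Definition piece_union (u : nat -> piece) s :=
  Piece (\bigcup_n vecs (u n)) (\bigcup_n funs (u n)) s.

Variables (r : G -> B -> B) (A : set B).

Definition countable_piece t :=
  [/\ countable (vecs t), countable (funs t) & funs t `<=` A].

(** One round of closing off: [w] contains whatever the conditions on a closed
    piece require of the elements of [t]. *)
Record piece_step t w : Prop := {
  step_le : piece_le t w;
  step_vec0 : vecs w 0;
  step_vecD : forall c c' (q : rat), vecs t c -> vecs t c' ->
    vecs w (c + ratr q *: c');
  step_fun0 : exists2 f, funs w f & forall x, ev f x = 0;
  step_funN : forall f, funs t f ->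
    exists2 g, funs w g & forall x, ev g x = - ev f x;
  step_midpoint : forall f g, funs t f -> funs t g ->
    exists2 h, funs w h & forall x, ev h x = (ev f x + ev g x) / 2;
  step_norming : forall c (e : R), vecs t c ->
    (forall f, funs w f -> `|ev f c| <= e) -> `|c| <= e;
  step_range : funs t `<=` range (r (stage w));
  step_determining : forall f g, (forall c, vecs w c -> ev f c = ev g c) ->
    r (stage t) f = r (stage t) g }.

(** A piece is closed when one round of the construction adds nothing. *)
Definition closed_piece t := countable_piece t /\ piece_step t t.

Hypothesis rs : retractional_skeleton R r.

Lemma retraction_agree_le (s s' : G) f g :
  (s <= s')%O -> r s' f = r s' g -> r s f = r s g.
Proof.
by move=> st fg; rewrite (rs_compat rs st f).1 fg -(rs_compat rs st g).1.
Qed.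

(** This lets a nondecreasing sequence of closed pieces count as a sequence of
    steps, so that one lemma on unions serves both cofinality and suprema. *)
Lemma piece_step_mono t t' w w' : piece_le t' t -> piece_le w w' ->
  piece_step t w -> piece_step t' w'.
Proof.
move=> tt ww [s1 s2 s3 s4 s5 s6 s7 s8 s9].
have [tv tf ts] := tt; have [wv wf ws] := ww.
split.
- exact: piece_le_trans (piece_le_trans tt s1) ww.
- exact: wv.
- by move=> c c' q /tv ? /tv ?; apply: wv; exact: s3.
- by have [f /wf ? ?] := s4; exists f.
- by move=> f /tf/s5[g /wf ? ?]; exists g.
- by move=> f g /tf tf' /tf/(s6 _ _ tf')[h /wf ? ?]; exists h.
- by move=> c e /tv tc H; apply: (s7 _ _ tc) => f /wf; exact: H.
- by move=> f /tf/s8; exact: (range_retraction_le rs).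
- move=> f g H; apply: (retraction_agree_le ts).
  by apply: s9 => c /wv; exact: H.
Qed.

Lemma piece_homo (u : nat -> piece) : (forall n, piece_le (u n) (u n.+1)) ->
  forall n m, (n <= m)%N -> piece_le (u n) (u m).
Proof.
move=> us n m /subnK <-; elim: (m - n)%N => [|k IH]; first exact: piece_le_refl.
exact: piece_le_trans IH (us _).
Qed.

Lemma piece_union_ge (u : nat -> piece) s : isLub (range (stage \o u)) s ->
  forall n, piece_le (u n) (piece_union u s).
Proof.
move=> [sub _] n; split=> /=.
- by move=> c cn; exists n.
- by move=> c cn; exists n.
- by apply: sub; exists n.
Qed.

(** Finitely many elements of the union already occur at one stage, and the
    next stage contains what they require; only the determining condition uses
    the continuity of the skeleton along [u]. *)
Lemma closed_piece_union (u : nat -> piece) s :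
  (forall n, countable_piece (u n)) -> (forall n, piece_step (u n) (u n.+1)) ->
  isLub (range (stage \o u)) s -> closed_piece (piece_union u s).
Proof.
move=> cu su lubs; have le_u := piece_homo (fun n => step_le (su n)).
have leU := piece_union_ge lubs.
have toU n : piece_step (u n) (piece_union u s).
  exact: piece_step_mono (piece_le_refl _) (leU n.+1) (su n).
have common (T : Type) (D : piece -> set T) :
    (forall t w, piece_le t w -> D t `<=` D w) -> forall a b n m,
    D (u n) a -> D (u m) b -> exists2 k, D (u k) a & D (u k) b.
  move=> Dle a b n m Da Db; exists (maxn n m).
    by apply: Dle Da; apply: le_u; exact: leq_maxl.
  by apply: Dle Db; apply: le_u; exact: leq_maxr.
split.
  split=> /=.
  - by apply: bigcup_countable => // n _; have [] := cu n.
  - by apply: bigcup_countable => // n _; have [] := cu n.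
  - by move=> f [n _]; have [_ _] := cu n; exact.
split.
- exact: piece_le_refl.
- exact: step_vec0 (toU 0%N).
- move=> c c' q [n _ cn] [m _ c'm].
  have [|k ck c'k] := common _ vecs _ _ _ _ _ cn c'm; first by move=> t w [].
  exact: (step_vecD (toU k)).
- exact: step_fun0 (toU 0%N).
- by move=> f [n _ fn]; exact: (step_funN (toU n)).
- move=> f g [n _ fn] [m _ gm].
  have [|k fk gk] := common _ funs _ _ _ _ _ fn gm; first by move=> t w [].
  exact: (step_midpoint (toU k)).
- by move=> c e [n _ cn]; exact: (step_norming (toU n)).
- by move=> f [n _ fn]; exact: (step_range (toU n)).
- move=> f g fg; apply: (lub_retraction_agree rs _ lubs).
    by move=> n m nm; have [] := le_u _ _ nm.
  by move=> n; exact: (step_determining (toU n)).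
Qed.

Hypotheses (Ar : A `<=` \bigcup_s range (r s))
  (A0 : exists2 f, A f & forall x, ev f x = 0)
  (AN : forall f, A f -> exists2 g, A g & forall x, ev g x = - ev f x)
  (Am : midpoint_closed A)
  (An : forall x (e : R), (forall f, A f -> `|ev f x| <= e) -> `|x| <= e).

(** Every requirement asks for countably many new elements. *)
Lemma exists_step t : countable_piece t ->
  exists2 w, countable_piece w & piece_step t w.
Proof.
move=> [cv cf fA].
have [z Az z0] := A0.
have /choice[ng ngP] : forall f, exists g, A f -> A g /\ forall x, ev g x = - ev f x.
  move=> f; have [/AN[g ? ?]|nA] := pselect (A f); first by exists g.
  by exists z => /nA.
have /choice[md mdP] : forall p : B * B, exists h, A p.1 -> A p.2 ->
    A h /\ forall x, ev h x = (ev p.1 x + ev p.2 x) / 2.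
  move=> [f g] /=; have [Af|nA] := pselect (A f); last by exists z => /nA.
  have [Ag|nA] := pselect (A g); last by exists z => _ /nA.
  by have [h ? ?] := Am Af Ag; exists h.
have /choice[nm nmP] : forall p : X * nat, exists f,
    A f /\ `|p.1| - p.2.+1%:R^-1 <= `|ev f p.1|.
  move=> [x n]; apply: contrapT => /forallNP H.
  have : `|x| <= `|x| - n.+1%:R^-1.
    apply: An => f Af; rewrite leNgt; apply/negP => /ltW lef.
    by apply: (H f).
  by rewrite lerBrDl gerDr leNgt invr_gt0 ltr0n.
have [s ts fs] := countable_absorbed rs (stage t) cf (subset_trans fA Ar).
have [D cD DP] := countable_determining (@rs_continuous _ _ _ _ _ rs (stage t))
  (rs_metrizable rs (stage t)).
pose V := vecs t `|` [set 0] `|`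
  [set p.1.1 + ratr p.2 *: p.1.2 | p in (vecs t `*` vecs t) `*` [set: rat]] `|` D.
pose W := funs t `|` [set z] `|` ng @` funs t `|` md @` (funs t `*` funs t) `|`
  nm @` (vecs t `*` [set: nat]).
exists (Piece V W s).
  split=> /=.
  - apply: countableU => //; apply: countableU.
      by apply: countableU => //; exact: countable1.
    by apply: countable_image; apply: countableX => //; exact: countableX.
  - apply: countableU; last by apply: countable_image; exact: countableX.
    apply: countableU; last by apply: countable_image; exact: countableX.
    apply: countableU; last exact: countable_image.
    by apply: countableU => //; exact: countable1.
  - move=> f [[[[/fA//|->//]|[g /fA Ag <-]]|[[g h] [/fA Ag /fA Ah] <-]]|[p _ <-]].
    + by have [] := ngP g Ag.
    + by have [] := mdP (g, h) Ag Ah.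
    + by have [] := nmP p.
split=> /=.
- by split=> //= a ta; [do 3 left|do 4 left].
- by left; left; right.
- by move=> c c' q tc tc'; left; right; exists (c, c', q).
- by exists z => //; do 3 left; right.
- move=> f tf; exists (ng f); first by left; left; right; exists f.
  by have [] := ngP f (fA _ tf).
- move=> f g tf tg; exists (md (f, g)); first by left; right; exists (f, g).
  by have [] := mdP (f, g) (fA _ tf) (fA _ tg).
- move=> c e tc H; apply/ler_addgt0Pr => e' e'0; have [N HN] := harmonic_lt e'0.
  have [_ /=] := nmP (c, N); have := HN N (leqnn _).
  have : `|ev (nm (c, N)) c| <= e by apply: H; right; exists (c, N).
  by move: N.+1%:R^-1 => w; lra.
- exact: fs.
- by move=> f g fg; apply: DP => c Dc; apply: fg; right.
Qed.

(** The union of the iterated steps is closed. *)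
Lemma exists_closed_piece t : countable_piece t ->
  exists2 w, closed_piece w & piece_le t w.
Proof.
move=> ct.
have /choice[nx nxP] : forall v : {t | countable_piece t},
    exists w : {t | countable_piece t}, piece_step (sval v) (sval w).
  by move=> [v cv]; have [w cw vw] := exists_step cv; exists (exist _ w cw).
pose u n := sval (iter n nx (exist _ t ct)).
have su n : piece_step (u n) (u n.+1) by exact: nxP.
have cu n : countable_piece (u n) by exact: svalP.
have ndu : nondecreasing_seq (stage \o u).
  by apply/nondecreasing_seqP => n; have [[]] := su n.
have [s lubs] := rs_sigma_complete rs ndu.
exists (piece_union u s); first exact: closed_piece_union.
exact: piece_union_ge lubs 0%N.
Qed.

End Pieces.

(** * From retractions to projections *)

Section ClosedPieces.
Context {R : realType} {X : normedModType R}.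
Local Notation B := (set_type (dual_ball X)).
Context {d : Order.disp_t} {G : porderType d}.
Variables (r : G -> B -> B) (A : set B).

Definition closed_pieces : Type := {t : piece | closed_piece r A t}.

HB.instance Definition _ := gen_eqMixin closed_pieces.
HB.instance Definition _ := gen_choiceMixin closed_pieces.

Definition closed_pieces_le (t w : closed_pieces) : bool :=
  `[< piece_le (sval t) (sval w) >].

Lemma closed_pieces_le_refl : reflexive closed_pieces_le.
Proof. by move=> t; apply/asboolP; exact: piece_le_refl. Qed.

Lemma closed_pieces_le_anti : antisymmetric closed_pieces_le.
Proof.
move=> t w /andP[/asboolP tw /asboolP wt]; apply: eq_sig_hprop.
  by move=> p u v; exact: Prop_irrelevance.
exact: piece_le_anti.
Qed.

Lemma closed_pieces_le_trans : transitive closed_pieces_le.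
Proof.
move=> u t w /asboolP tu /asboolP uw; apply/asboolP.
exact: piece_le_trans uw.
Qed.

HB.instance Definition _ := Order.Le_isPOrder.Build d closed_pieces
  closed_pieces_le_refl closed_pieces_le_anti closed_pieces_le_trans.

Lemma closed_pieces_leP (t w : closed_pieces) :
  reflect (piece_le (sval t) (sval w)) (t <= w)%O.
Proof. exact: asboolP. Qed.

End ClosedPieces.

Section ProjectionalSkeletonOfRetractions.
Context {R : realType} {X : completeNormedModType R}.
Local Notation B := (set_type (dual_ball X)).

(** The skeleton is indexed by the closed pieces: containment of the vectors
    and of the functionals gives the two compatibility equations. *)
Lemma projectional_skeleton_of_retractional (A S : set B) :
  induced_by_retractional_skeleton R S -> A `<=` S ->
  (exists2 f, A f & forall x, ev f x = 0) ->
  (forall f, A f -> exists2 g, A g & forall x, ev g x = - ev f x) ->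
  midpoint_closed A ->
  (forall x (e : R), (forall f, A f -> `|ev f x| <= e) -> `|x| <= e) ->
  exists2 D : set (dual X), induced_by_projectional_skeleton 1 D &
    forall f, A f -> D (set_val f).
Proof.
move=> [d [G [r [rs SE]]]] AS A0 AN Am An.
have Ar : A `<=` \bigcup_s range (r s) by rewrite -SE.
pose I : porderType d := closed_pieces r A.
pose V (t : I) := vecs (sval t); pose W (t : I) := funs (sval t).
have vec0 t : V t 0 by exact: (step_vec0 (svalP t).2).
have vecD t c c' (q : rat) : V t c -> V t c' -> V t (c + ratr q *: c').
  exact: (step_vecD (svalP t).2).
have vec_norming t y (e : R) : closure (V t) y ->
    (forall f, W t f -> `|ev f y| <= e) -> `|y| <= e.
  by apply: norming_closure => c e'; exact: (step_norming (svalP t).2).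
have /choice[P PP] : forall t : I, exists P : {linear X -> X},
  [/\ forall x, closure (V t) (P x), forall f x, W t f -> ev f (P x) = ev f x,
      forall x, `|P x| <= `|x| & forall y, closure (V t) y -> P y = y].
  move=> t; have st := (svalP t).2; apply: exists_projection => //.
  - exact: vecD.
  - exact: (step_fun0 st).
  - exact: (step_funN st).
  - exact: (step_midpoint st).
  - by move=> c e; exact: (step_norming st).
  move=> f g Ff Fg fg.
  rewrite -(closure_range_retraction rs (step_range st) Ff).
  rewrite -(closure_range_retraction rs (step_range st) Fg).
  exact: (step_determining st).
have PV t x : closure (V t) (P t x) by have [] := PP t.
have PW t f x : W t f -> ev f (P t x) = ev f x by have [_] := PP t; move=> + _ _; exact.
have Ple t x : `|P t x| <= `|x| by have [] := PP t.
have Pid t y : closure (V t) y -> P t y = y by have [] := PP t; move=> _ _ _; exact.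
have rangeP t : range (P t) = closure (V t).
  apply/seteqP; split=> [_ [x _ <-]//|y Vy].
  by exists y => //; exact: Pid.
have uniq t y z : closure (V t) y -> closure (V t) z ->
    (forall f, W t f -> ev f y = ev f z) -> y = z.
  move=> Cy Cz yz; apply/eqP; rewrite -subr_eq0 -normr_le0.
  apply: (vec_norming t).
    by apply: (closure_ratB (vec0 t)) => //; exact: vecD.
  by move=> f Ff; rewrite evB yz// subrr normr0.
have start (c : X) (f : B) (s : G) : A f -> exists t : I, V t c /\ W t f.
  move=> Af; have [|t ct [ge1 ge2 _]] :=
      @exists_closed_piece _ _ _ _ r A rs Ar A0 AN Am An (Piece [set c] [set f] s).
    by split=> /=; [exact: countable1|exact: countable1|move=> _ ->].
  by exists (exist _ t ct); split; [exact: ge1|exact: ge2].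
have [z Az z0] := A0.
have [s0 _ _] := Ar z Az.
have lubI (u : nat -> I) : nondecreasing_seq u -> exists2 t : I,
    isLub (range u) t & V t = \bigcup_n V (u n).
  move=> ndu.
  have nds : nondecreasing_seq (fun n => stage (sval (u n))).
    by move=> n m /ndu/closed_pieces_leP[].
  have [s lubs] := rs_sigma_complete rs nds.
  have cw : closed_piece r A (piece_union (fun n => sval (u n)) s).
    apply: closed_piece_union => //; first by move=> n; exact: (svalP (u n)).1.
    move=> n; apply: (piece_step_mono rs (piece_le_refl _)) (svalP (u n)).2.
    by apply/closed_pieces_leP; exact: ndu.
  exists (exist _ _ cw) => //; split.
    move=> _ [n _ <-]; apply/closed_pieces_leP.
    exact: (piece_union_ge (u := fun n => sval (u n)) lubs).
  move=> b ub; apply/closed_pieces_leP => /=.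
  have ubn n : piece_le (sval (u n)) (sval b).
    by apply/closed_pieces_leP; apply: ub; exists n.
  split=> /= [c [n _]|f [n _]|].
  - by have [+ _ _] := ubn n; exact.
  - by have [_ + _] := ubn n; exact.
  - by apply: lubs.2 => _ [n _ <-]; have [] := ubn n.
have bP t : bounded_near (P t) (nbhs (0 : X)).
  by apply/bounded_funP => e; exists e => x; apply: le_trans; exact: Ple.
exists (\bigcup_t adjoint_range (P t)); last first.
  move=> f Af; have [t [_ Wf]] := start 0 f s0 Af; exists t => //.
  by exists (set_val f) => x; rewrite -[RHS]/(ev f (P t x)) PW.
exists d, I, P; split=> //; split; last first.
  by move=> t; have [_] := opnorm_le1 (bP t); apply; exact: Ple.
split=> //.
- move=> t w; have [s [ts ws]] := rs_up_directed rs (stage (sval t)) (stage (sval w)).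
  have [ct _] := svalP t; have [cw _] := svalP w.
  have [|v cv [vV vW vs]] :=
      @exists_closed_piece _ _ _ _ r A rs Ar A0 AN Am An
        (Piece (V t `|` V w) (W t `|` W w) s).
    case: ct => ? ? tA; case: cw => ? ? wA.
    split=> /=; [exact: countableU|exact: countableU|].
    by move=> f [/tA|/wA].
  exists (exist _ v cv); split; apply/closed_pieces_leP; split=> /=.
  + by move=> c tc; apply: vV; left.
  + by move=> c tc; apply: vW; left.
  + exact: le_trans vs.
  + by move=> c tc; apply: vV; right.
  + by move=> c tc; apply: vW; right.
  + exact: le_trans vs.
- by move=> u /lubI[t lubt _]; exists t.
- by move=> t x; apply: Pid.
- move=> t; exists (V t); split.
  + by have [[]] := svalP t.
  + by rewrite rangeP; exact: subset_closure.
  + by rewrite rangeP.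
- apply/seteqP; split=> // x _; have [t [Vx _]] := start x z s0 Az.
  by exists t => //; exists x => //; apply/Pid/subset_closure.
- move=> t w /closed_pieces_leP[tV tW _] x; split.
    by apply: (uniq t) => // f Wf; rewrite !PW//; exact: tW.
  by rewrite [RHS]Pid//; exact: (closureS tV (PV t x)).
- move=> u t incu lubt.
  have [w lubw Vw] : exists2 w : I, isLub (range u) w & V w = \bigcup_n V (u n).
    by apply: lubI => n m; rewrite incu.
  have -> : t = w.
    by apply/eqP; rewrite eq_le (lubt.2 _ lubw.1) (lubw.2 _ lubt.1).
  rewrite rangeP Vw; apply/seteqP; split.
    by apply: closureS => c [n _ Vc]; exists n => //; rewrite rangeP;
      exact: subset_closure.
  rewrite closureE; apply: smallest_sub; first exact: closed_closure.
  move=> c [n _]; rewrite rangeP; apply: closureS => y Vy.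
  by exists n.
Qed.

End ProjectionalSkeletonOfRetractions.

(** * The equivalences *)

Section InducedSets.
Context {R : realType} {X : normedModType R}.
Local Notation B := (set_type (dual_ball X)).

Lemma adjoint_range_lin (P : X -> X) (a b : R) (f g : dual X) :
  adjoint_range P f -> adjoint_range P g -> adjoint_range P (a *: f + b *: g).
Proof.
move=> [f' fE] [g' gE]; exists (a *: f' + b *: g') => x.
by rewrite -[LHS]/(a * f x + b * g x) fE gE.
Qed.

(** The adjoint ranges are subspaces, and they are directed by inclusion. *)
Lemma induced_lin (D : set (dual X)) (a b : R) f g :
  induced_by_projectional_skeleton 1 D -> D f -> D g -> D (a *: f + b *: g).
Proof.
move=> [d [G [P [[sP _] ->]]]] [s _ [f' fE]] [t _ [g' gE]].
have [u [su tu]] := ps_up_directed sP s t.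
exists u => //; apply: adjoint_range_lin.
  by exists f => x; rewrite !fE -(ps_compat sP su x).1.
by exists g => x; rewrite !gE -(ps_compat sP tu x).1.
Qed.

Lemma induced_ball_convex_symmetric (D : set (dual X)) :
  induced_by_projectional_skeleton 1 D ->
  convex_set (of_ball (to_ball D)) /\ symmetric_set (of_ball (to_ball D)).
Proof.
move=> iD.
have lin (a b : R) (f g : B) : `|a| + `|b| <= 1 -> D (set_val f) -> D (set_val g) ->
    of_ball (to_ball D) (a *: (set_val f : dual X) + b *: (set_val g : dual X)).
  move=> ab Df Dg; have [|h hE] :=
      @ball_ofP _ _ (a *: (set_val f : dual X) + b *: (set_val g : dual X)).
    move=> x; rewrite -[X in `|X|]/(a * ev f x + b * ev g x).
    rewrite (le_trans (ler_normD _ _))// !normrM.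
    have fx := ev_le f x; have gx := ev_le g x.
    rewrite (@le_trans _ _ ((`|a| + `|b|) * `|x|))//; last by rewrite ler_piMl.
    by rewrite mulrDl lerD// ler_wpM2l.
  exists h => //; rewrite /to_ball /= hE; exact: induced_lin.
split=> [f g l /set_mem[f' Df <-] /set_mem[g' Dg <-]|f [f' Df <-]].
  apply/mem_set; apply: (lin l%:inum (1 - l%:inum)) => //.
  have l0 : 0 <= l%:inum :> R by [].
  have l1 : l%:inum <= 1 :> R by [].
  by rewrite !ger0_norm ?subr_ge0// addrC subrK.
have := lin (-1) 0 f' f'; rewrite normrN normr1 normr0 addr0 scaleN1r scale0r addr0.
exact.
Qed.

End InducedSets.

Section MainTheorem.
Context {R : realType} {X : completeNormedModType R}.
Local Notation B := (set_type (dual_ball X)).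

(** The induced set is dense in the ball, since every point is the limit of its
    retracts, and so it norms as well as the whole ball does. *)
Lemma projectional_of_convex_symmetric (A : set B) :
  convex_set (of_ball A) -> symmetric_set (of_ball A) ->
  induced_by_retractional_skeleton R A -> has_projectional_skeleton X 1.
Proof.
move=> cA sA iA; have [d [G [r [rs AE]]]] := iA.
have lim b (U : set B) : nbhs b U -> exists s, U (r s b).
  move=> /(rs_lim rs)[s _ sU]; exists s; exact: (sU s (lexx s)).
have AN f : A f -> exists2 g, A g & forall x, ev g x = - ev f x.
  move=> Af; have [|g Ag gE] := sA (set_val f); first by exists f.
  by exists g => // x; rewrite /ev gE.
have Am : midpoint_closed A.
  move=> f g Af Ag.
  have h1 : (2^-1 : R) <= 1 by rewrite invf_le1// ler1n.
  have h0 : 0 <= (2^-1 : R) by rewrite invr_ge0.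
  have := cA (set_val f) (set_val g) (Itv01 h0 h1) _ _.
  rewrite !inE => /(_ (ex_intro2 _ _ f Af erefl) (ex_intro2 _ _ g Ag erefl)).
  move=> [h Ah hE]; exists h => // x; rewrite /ev hE.
  by rewrite -[LHS]/(2^-1 * ev f x + (1 - 2^-1) * ev g x) /ev; field.
have [||D [d' [G' [P [PP _]]]] _] :=
    @projectional_skeleton_of_retractional R X A A iA (fun _ => id) _ AN Am.
- have [b0 _] := @norm_attained R X 0; have [s _] := lim b0 setT filterT.
  have Ar : A (r s b0) by rewrite AE; exists s.
  have [g Ag gE] := AN _ Ar; have [h Ah hE] := Am _ _ Ar Ag.
  by exists h => // x; rewrite hE gE subrr mul0r.
- move=> x e fe; have [b bx] := norm_attained x.
  apply/ler_addgt0Pr => e' e'0; have [s /= sb] := lim b _ (nbhs_basic b [:: x] e'0).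
  have := sb x; rewrite inE eqxx bx => /(_ isT).
  have : `|ev (r s b) x| <= e by apply: fe; rewrite AE; exists s.
  rewrite ler_norml ltr_norml; lra.
by exists d', G', P.
Qed.

(** The unit ball of [D] generates [D], and the set induced by a projectional
    skeleton is stable under scaling. *)
Lemma norming_subspace_induced (D : set (dual X)) (S : set B) :
  linear_subspace D -> norming 1 D ->
  induced_by_retractional_skeleton R S -> to_ball D `<=` S ->
  exists2 E : set (dual X), induced_by_projectional_skeleton 1 E & D `<=` E.
Proof.
move=> [D0 DL] nD iS DS.
have {}D0 : D 0 by apply: set_mem; exact: D0.
have {}DL (a : R) f g : D f -> D g -> D (a *: f + g).
  by move=> Df Dg; apply: set_mem; apply: DL; exact: mem_set.
have DZ (a : R) f : D f -> D (a *: f).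
  by move=> Df; rewrite -[_ *: _]addr0; exact: DL.
have [||||E iE DE] := @projectional_skeleton_of_retractional R X _ S iS DS.
- have [|b bE] := @ball_ofP _ X 0; first by move=> x; rewrite normr0.
  by exists b => [|x]; rewrite /to_ball /ev/= bE.
- move=> f Df; have [|b bE] := @ball_ofP _ X (-1 *: (set_val f : dual X)).
    by move=> x; rewrite -[X in `|X|]/(-1 * ev f x) mulN1r normrN ev_le.
  exists b => [|x]; first by rewrite /to_ball /= bE; exact: DZ.
  by rewrite {1}/ev bE -[LHS]/(-1 * ev f x) mulN1r.
- move=> f g Df Dg.
  pose h : dual X := 2^-1 *: (set_val f : dual X) + 2^-1 *: (set_val g : dual X).
  have hx x : h x = (ev f x + ev g x) / 2 :> R.
    by rewrite -[LHS]/(2^-1 * ev f x + 2^-1 * ev g x); field.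
  have [|b bE] := @ball_ofP _ X h.
    move=> x; rewrite hx; have := ev_le f x; have := ev_le g x.
    rewrite !ler_norml; lra.
  exists b => [|x]; last by rewrite {1}/ev bE hx.
  by rewrite /to_ball /= bE; apply: DL => //; exact: DZ.
- move=> x e fe; apply: le_trans (nD x) _; rewrite mul1r; apply: ge_sup.
    by exists `|(0 : dual X) x|, 0 => //; split=> //; apply/dual_ballP => y;
      rewrite normr0.
  move=> _ [f [Df /dual_ballP/ball_ofP[b bE]] <-].
  by have := fe b; rewrite /to_ball /= /ev bE; apply.
exists E => // f Df.
have [M [M0 fM]] : exists M : R, 0 < M /\ forall x, `|f x : R| <= M * `|x|.
  have /linear_bounded_continuous/linear_boundedP/pinfty_ex_gt0[M M0 fM] :
    continuous (dual_lin f) by exact: dual_continuous.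
  by exists M.
have [|b bE] := @ball_ofP _ X (M^-1 *: f).
  move=> x; rewrite -[X in `|X|]/(M^-1 * f x) normrM gtr0_norm ?invr_gt0//.
  by rewrite ler_pdivrMl.
have Eb : E (set_val b) by apply: DE; rewrite /to_ball /= bE; exact: DZ.
have := induced_lin M 0 iE Eb Eb.
by rewrite bE scale0r addr0 scalerA divff ?gt_eqF// scale1r.
Qed.

End MainTheorem.

Theorem theorem4p2 (R : realType) (X : completeNormedModType R) :
  (has_projectional_skeleton X 1 <->
   exists A : set (set_type (dual_ball X)),
     [/\ convex_set (of_ball A), symmetric_set (of_ball A) &
         induced_by_retractional_skeleton R A])
  /\
  (forall D : set (dual X), linear_subspace D -> norming 1 D ->
     (induced_by_projectional_skeleton 1 D ->
      induced_by_retractional_skeleton R (to_ball D))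
     /\
     ((exists E : set (dual X),
         induced_by_projectional_skeleton 1 E /\ D `<=` E) <->
      (exists S : set (set_type (dual_ball X)),
         induced_by_retractional_skeleton R S /\ to_ball D `<=` S))).
Proof.
split.
  split=> [[d [G [P PP]]]|[A [cA sA iA]]].
    have iD : induced_by_projectional_skeleton 1 (\bigcup_s adjoint_range (P s)).
      by exists d, G, P.
    have [cD sD] := induced_ball_convex_symmetric iD.
    by exists (to_ball (\bigcup_s adjoint_range (P s))); split=> //;
      exact: adjoint_retractional_skeleton.
  exact: projectional_of_convex_symmetric iA.
move=> D lD nD; split; first exact: adjoint_retractional_skeleton.
split=> [[E [iE DE]]|[S [iS DS]]].
  exists (to_ball E); split; first exact: adjoint_retractional_skeleton.
  by move=> f; exact: DE.
by have [E iE DE] := norming_subspace_induced lD nD iS DS; exists E.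
Qed.
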